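(* Let $P_t(x,\cdot)$ be symmetric and have density $p_t(x,y)$ with respect to $\mu$. Suppose that the diagonal elements satisfy $p_s(\cdot,\cdot)\in L^{1/2}_{\mathrm{loc}}(\mu)$ for some $s>0$, and that a set $\mathcal K$ of bounded functions with compact support is dense in $L^2(\mu)$. Then $\lambda_0=\varepsilon_{\max}$.
   Context: $P_t(x,\cdot)$, $t\ge0$, is the (possibly sub-Markovian) transition function of a Markov process on a state space $E$, $\mu$ is the measure on $E$ with respect to which it is symmetric, and $(P_t)_{t\ge0}$ is the associated semigroup on $L^2(\mu)$ with generator $L$. Write $\mu(f)=\int_E f\,d\mu$. The diagonal condition $p_s(\cdot,\cdot)\in L^{1/2}_{\mathrm{loc}}(\mu)$ means that the function $x\mapsto p_s(x,x)^{1/2}$ is locally $\mu$-integrable, i.e. $\int_K p_s(x,x)^{1/2}\mu(dx)<\infty$ for every compact $K\subset E$. $\lambda_0=\inf\{-\mu(fLf): f\in\mathcal C,\ \mu(f^2)=1\}$, where $\mathcal C$ is a suitable core of the generator $L$ (for instance the smooth functions with compact support in the case of diffusions); it is the largest $\eta\ge0$ such that $\mu((P_tf)^2)\le\mu(f^2)e^{-2\eta t}$ for all $t\ge0$ and $f\in L^2(\mu)$. $\varepsilon_{\max}$ is the maximal rate $\varepsilon\ge0$ in the exponential convergence $$P_t(x,K)\le c(x,K)e^{-\varepsilon t},\qquad t\ge0,\ x\in E,\ K\text{ compact},$$ where for each compact $K$ the function $c(\cdot,K)$ is locally $\mu$-integrable.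
   Formalization: The density is required to be symmetric and to satisfy Chapman–Kolmogorov at all points (otherwise its diagonal is arbitrary on null sets and the claim can fail), with p_s(x,x) finite for every x; μ is taken σ-finite and finite on compact sets, and E Hausdorff with Borel sets. *)

(* Defs.v *)
From HB Require Import structures.
From mathcomp Require Import all_boot all_order all_algebra.
From mathcomp Require Import all_classical all_reals all_analysis.
From mathcomp Require Import measurable_realfun.

Set Implicit Arguments.
Unset Strict Implicit.
Unset Printing Implicit Defensive.
Import Order.TTheory GRing.Theory Num.Theory.
Import numFieldNormedType.Exports.

Local Open Scope classical_set_scope.
Local Open Scope ring_scope.

(* The space E equipped with its Borel sigma-algebra. *)
Notation borel E := (g_sigma_algebraType (@open E)).

Section Defs.
Variables (R : realType) (E : ptopologicalType).
Variable mu : {measure set (borel E) -> \bar R}.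

Definition finite_on_compacts : Prop :=
  forall K : set E, compact K -> (mu K < +oo)%E.

Definition locally_mu_integrable (c : borel E -> R) : Prop :=
  measurable_fun [set: borel E] c /\
  forall K : set E, compact K -> mu.-integrable K (EFin \o c).

(* A function in L^{1/2}_loc is finite at every point: the bound
   P_t(x,K) <= c(x,K) e^{-eps t} is required for every x with c(x,K) finite,
   and it can fail on a null set where the diagonal density is infinite. *)
Definition in_Lhalf_loc (g : borel E -> \bar R) : Prop :=
  [/\ forall x, g x \is a fin_num,
      measurable_fun [set: borel E] g &
      forall K : set E, compact K ->
        (\int[mu]_(x in K) (g x `^ 2^-1) < +oo)%E].

Definition bounded_compact_support (f : borel E -> R) : Prop :=
  [/\ measurable_fun [set: borel E] f,
      exists M : R, forall x, `|f x| <= M &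
      compact (closure ([set x | f x != 0] : set E))].

Definition dense_in_L2 (D : set (borel E -> R)) : Prop :=
  D `<=` [set f | f \in Lfun mu 2%:E] /\
  forall f : borel E -> R, f \in Lfun mu 2%:E -> forall e : R, 0 < e ->
    exists2 g, D g & ('N[mu]_2%:E[EFin \o (f \- g)%R] < e%:E)%E.

(* Only the kernels P t with 0 <= t are meaningful. *)
Variable P : R -> R.-spker (borel E) ~> (borel E).

Definition transition_function : Prop :=
  (forall x (A : set (borel E)), measurable A -> P 0 x A = \d_x A) /\
  (forall s t : R, 0 <= s -> 0 <= t -> forall x (A : set (borel E)),
     measurable A -> P (s + t) x A = (\int[P s x]_y P t y A)%E).

Definition mu_symmetric : Prop :=
  forall t : R, 0 <= t -> forall A B : set (borel E),
    measurable A -> measurable B ->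
    (\int[mu]_(x in A) P t x B = \int[mu]_(x in B) P t x A)%E.

(* The version of the density for which symmetry and Chapman-Kolmogorov hold
   at every pair of points; the diagonal values p t x x are determined by it,
   whereas a density known up to null sets has no well-defined diagonal. *)
Record transition_density (p : R -> borel E -> borel E -> \bar R) : Prop :=
  TransitionDensity {
    density_ge0 : forall t : R, 0 < t -> forall x y, (0 <= p t x y)%E;
    density_measurable : forall t : R, 0 < t ->
      measurable_fun [set: borel E * borel E] (fun z => p t z.1 z.2);
    densityE : forall t : R, 0 < t -> forall x (A : set (borel E)),
      measurable A -> P t x A = (\int[mu]_(y in A) p t x y)%E;
    density_sym : forall t : R, 0 < t -> forall x y, p t x y = p t y x;
    density_CK : forall s t : R, 0 < s -> 0 < t -> forall x y,
      p (s + t) x y = (\int[mu]_z (p s x z * p t z y))%E }.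

(* Elements of L^2(mu) are represented by functions.  For f in L^2(mu) the
   integral below is finite for mu-almost every x. *)
Definition semigroup (t : R) (f : borel E -> R) : borel E -> R :=
  fun x => \int[P t x]_y f y.

Definition strongly_continuous : Prop :=
  forall f : borel E -> R, f \in Lfun mu 2%:E ->
    'N[mu]_2%:E[EFin \o (semigroup t f \- f)%R]%E @[t --> 0^'+] --> 0%E.

(* The graph of the generator: f is in the domain of L and L f = g, both up to
   mu-null sets. *)
Definition generator (f g : borel E -> R) : Prop :=
  [/\ f \in Lfun mu 2%:E, g \in Lfun mu 2%:E &
      'N[mu]_2%:E[EFin \o (fun x => t^-1 * (semigroup t f x - f x) - g x)%R]%E
        @[t --> 0^'+] --> 0%E].

(* A linear subspace of the domain, dense in it for the graph norm. *)
Definition is_core (C : set (borel E -> R)) : Prop :=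
  [/\ forall (a : R) f g, C f -> C g -> C (fun x => a * f x + g x),
      forall f, C f -> exists g, generator f g &
      forall f g, generator f g -> forall e : R, 0 < e ->
        exists f' g', [/\ C f', generator f' g',
          ('N[mu]_2%:E[EFin \o (f \- f')%R] < e%:E)%E &
          ('N[mu]_2%:E[EFin \o (g \- g')%R] < e%:E)%E]].

Definition lambda0 (C : set (borel E -> R)) : \bar R :=
  ereal_inf [set l | exists f g, [/\ C f, generator f g,
    (\int[mu]_x (f x ^+ 2)%:E = 1)%E &
    l = (- \int[mu]_x (f x * g x))%:E]].

Definition exp_rate (eps : R) : Prop :=
  0 <= eps /\
  forall K : set E, compact K ->
    exists2 c : borel E -> R, locally_mu_integrable c &
      forall (t : R) x, 0 <= t -> (P t x K <= (c x * expR (- eps * t))%:E)%E.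

Definition eps_max : \bar R := ereal_sup [set eps%:E | eps in exp_rate].

End Defs.

(* Main.v *)
Require Import Defs.
From HB Require Import structures.
From mathcomp Require Import all_boot all_order all_algebra.
From mathcomp Require Import all_classical all_reals all_analysis.
From mathcomp Require Import measurable_realfun.
From mathcomp Require Import ring lra.

Set Implicit Arguments.
Unset Strict Implicit.
Unset Printing Implicit Defensive.
Import Order.TTheory GRing.Theory Num.Theory.
Import numFieldNormedType.Exports.

Local Open Scope classical_set_scope.
Local Open Scope ring_scope.

(** Both sides of the equality measure the decay of the semigroup on
    L^2(mu).  Write |f| for the norm of L^2(mu), and say that f decays at rate
    eta when |P_t f| <= |f| e^(- eta t) for all t >= 0.  Symmetry gives
    |P_t f|^2 = <P_2t f, f> <= |P_2t f| |f|: along an orbit the norm is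
    log-convex in t, so that a bound |P_t f| <= C e^(- eta t) with an arbitrary
    constant C already forces decay at rate eta ([decays_boost]).

    From a rate eps in the convergence of P_t(x, K) to the spectral bound
    eps <= lambda_0: for g bounded with compact support K, the number
    |P_t g|^2 = <P_2t g, g> is at most a constant times the integral over K of
    P_2t(x, K), hence at most a constant times e^(- 2 eps t); so g decays at
    rate eps ([exp_rate_decays]), and so does every f in L^2(mu) by density
    ([decays_closed]).  Differentiating |P_t f|^2 <= |f|^2 e^(- 2 eps t) at
    t = 0 gives - <f, L f> >= eps |f|^2 on the domain of L ([decays_gen]).

    From eta <= lambda_0 to the rate eta: the inequality
    - <f, L f> >= eta |f|^2 extends from the core to the whole domain
    ([gen_core]), and on the domain it integrates to decay at rate eta, because
    t |-> <P_t f, f> is convex ([gen_decays]).  To reach the vectors outside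
    the domain, elements of the domain have to be produced: they are the means
    of r |-> P_r f over [0, 1], obtained as limits of Riemann means
    ([riemann_mean_gen]), and since r |-> <P_r f, f> is nonincreasing, the decay
    of the mean controls the decay of P_(t + 1) f ([gen_decays_all]).
    Finally, with a = s / 2, the identity
    |p_a(x, .)|^2 = p_s(x, x) turns decay in L^2(mu) into a bound at every
    point: P_t(x, K) = <p_a(x, .), P_(t - a) 1_K> is at most
    p_s(x, x)^(1/2) |P_(t - a) 1_K| ([semigroup_le]).

    The same pointwise bound is what makes the Riemann means converge: a
    Cauchy sequence of L^2(mu) becomes, after one application of P_a, a sequence
    that converges at every point, and Fatou's lemma makes the pointwise limit
    the limit in L^2(mu) ([semigroup_complete]).

    The argument on the semigroup is carried out in an abstract vector space
    with a positive semidefinite form, where two vectors with the same inner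
    products need not be equal; this matches functions that are only determined
    almost everywhere. *)

(** * Semi-inner products *)

Lemma exists_nat_gt (R : realType) (x : R) : exists n : nat, x < n%:R.
Proof.
by exists (Num.bound `|x|); rewrite (le_lt_trans (ler_norm _))// archi_boundP.
Qed.

Lemma ler_addgt0M (R : realFieldType) (x y c : R) : 0 <= c ->
  (forall e, 0 < e -> x <= y + e * c) -> x <= y.
Proof.
move=> c0 H; apply/ler_addgt0Pr => e e0.
have c1 : 0 < c + 1 by rewrite ltr_wpDl.
apply: le_trans (H (e / (c + 1)) _) _; first exact: divr_gt0.
rewrite lerD2l mulrAC ler_pdivrMr// mulrDr mulr1 lerDl; exact: ltW.
Qed.

Record semi_inner (R : realType) (V : lmodType R) (ip : V -> V -> R) : Prop :=
  SemiInner {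
    ipC : forall f g, ip f g = ip g f;
    ipP : forall a f g h, ip (a *: f + g) h = a * ip f h + ip g h;
    ip_ge0 : forall f, 0 <= ip f f }.

Section SemiInner.
Variables (R : realType) (V : lmodType R) (ip : V -> V -> R).
Hypothesis ip_semi : semi_inner ip.

Let ipC' := ipC ip_semi.
Let ipP' := ipP ip_semi.
Let ip_ge0' := ip_ge0 ip_semi.

Lemma ip0l g : ip 0 g = 0.
Proof.
have := ipP' 1 0 0 g; rewrite scale1r addr0 mul1r => /eqP.
by rewrite -subr_eq subrr eq_sym => /eqP.
Qed.

Lemma ipDl f g h : ip (f + g) h = ip f h + ip g h.
Proof. by have := ipP' 1 f g h; rewrite scale1r mul1r. Qed.

Lemma ipZl a f h : ip (a *: f) h = a * ip f h.
Proof. by have := ipP' a f 0 h; rewrite addr0 ip0l addr0. Qed.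

Lemma ipNl f h : ip (- f) h = - ip f h.
Proof. by rewrite -scaleN1r ipZl mulN1r. Qed.

Lemma ipBl f g h : ip (f - g) h = ip f h - ip g h.
Proof. by rewrite ipDl ipNl. Qed.

Lemma ipDr f g h : ip h (f + g) = ip h f + ip h g.
Proof. by rewrite ipC' ipDl !(ipC' h). Qed.

Lemma ipZr a f h : ip h (a *: f) = a * ip h f.
Proof. by rewrite ipC' ipZl !(ipC' h). Qed.

Lemma ipBr f g h : ip h (f - g) = ip h f - ip h g.
Proof. by rewrite ipC' ipBl !(ipC' h). Qed.

Lemma ip_suml I (r : seq I) (P : pred I) (F : I -> V) h :
  ip (\sum_(i <- r | P i) F i) h = \sum_(i <- r | P i) ip (F i) h.
Proof.
elim/big_rec2 : _ => [|i x y _ <-]; first exact: ip0l.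
by rewrite ipDl.
Qed.

Definition ipnorm f := Num.sqrt (ip f f).

Lemma ipnorm_ge0 f : 0 <= ipnorm f. Proof. exact: sqrtr_ge0. Qed.
Hint Resolve ipnorm_ge0 : core.

Lemma ipnorm_sqr f : ipnorm f ^+ 2 = ip f f. Proof. exact: sqr_sqrtr. Qed.

(** Cauchy-Schwarz, from the positivity of the form on a combination of the two
    vectors.  When g is a null vector the usual combination says nothing, and a
    large multiple of g is subtracted from f instead. *)
Lemma ip_le_norm f g : ip f g <= ipnorm f * ipnorm g.
Proof.
rewrite -sqrtrM//.
have [//|fg0] := leP (ip f g) 0; first by move/le_trans; apply; exact: sqrtr_ge0.
rewrite -[leLHS]ger0_norm; last exact: ltW.
rewrite -sqrtr_sqr ler_wsqrtr//.
have := ip_ge0' (ip g g *: f - ip f g *: g).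
rewrite !(ipBl, ipBr, ipZl, ipZr) (ipC' g f).
have := ip_ge0' g; rewrite le_eqVlt => /predU1P[g0|g0].
  (* Subtracting c *: g with c <f, g> > |f|^2 would give a negative square. *)
  have := ip_ge0' (f - ((ip f f + 1) / (ip f g)) *: g).
  rewrite !(ipBl, ipBr, ipZl, ipZr) (ipC' g f) -g0.
  rewrite !mulr0 subr0 divfK ?gt_eqF//.
  have := ip_ge0' f; nra.
move=> H; rewrite -subr_ge0 -(pmulr_rge0 _ g0).
by apply: le_trans H _; rewrite le_eqVlt; apply/orP; left; apply/eqP; ring.
Qed.

Lemma ipnormZ a f : ipnorm (a *: f) = `|a| * ipnorm f.
Proof.
by rewrite /ipnorm ipZl ipZr mulrA sqrtrM -?expr2 ?sqr_ge0// sqrtr_sqr.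
Qed.

Lemma ipnormN f : ipnorm (- f) = ipnorm f.
Proof. by rewrite -scaleN1r ipnormZ normrN1 mul1r. Qed.

Lemma ipnorm0 : ipnorm 0 = 0.
Proof. by rewrite /ipnorm ip0l sqrtr0. Qed.

Lemma ler_ipnormD f g : ipnorm (f + g) <= ipnorm f + ipnorm g.
Proof.
rewrite -(@ler_pXn2r _ 2) ?nnegrE ?addr_ge0//.
rewrite ipnorm_sqr ipDl !ipDr (ipC' g f) -!ipnorm_sqr.
have := ip_le_norm f g; nra.
Qed.

Lemma ler_ipnorm_sum I (r : seq I) (P : pred I) (F : I -> V) :
  ipnorm (\sum_(i <- r | P i) F i) <= \sum_(i <- r | P i) ipnorm (F i).
Proof.
elim/big_rec2 : _ => [|i x y _ H]; first by rewrite ipnorm0.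
by rewrite (le_trans (ler_ipnormD _ _))// lerD2l.
Qed.

Lemma ler_ipnormB f g : ipnorm (f - g) <= ipnorm f + ipnorm g.
Proof. by rewrite -(ipnormN g) ler_ipnormD. Qed.

Lemma ipnormB f g : ipnorm (f - g) = ipnorm (g - f).
Proof. by rewrite -ipnormN opprB. Qed.

Lemma ler_ip_normM f g : `|ip f g| <= ipnorm f * ipnorm g.
Proof.
rewrite ler_norml ip_le_norm andbT lerNl -ipNl -(ipnormN f).
exact: ip_le_norm.
Qed.

(** Identities satisfied by the operators of a semigroup hold only up to null
    vectors; this lemma transports them to norms. *)
Lemma eq_ipnorm f g : (forall h, ip f h = ip g h) -> ipnorm f = ipnorm g.
Proof. by move=> fg; rewrite /ipnorm fg ipC' fg. Qed.


(** * Semigroups of symmetric contractions *)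

(** The field [semigroupM] merges symmetry and the semigroup law; with
    [semigroup0] it also implies linearity up to null vectors, since
    <T_t f, g> = <f, T_t g> is linear in f. *)
Record symm_semigroup (T : R -> V -> V) : Prop := SymmSemigroup {
  semigroup0 : forall f g, ip (T 0 f) g = ip f g;
  semigroupM : forall (s t : R) f g, 0 <= s -> 0 <= t ->
    ip (T s f) (T t g) = ip (T (s + t) f) g;
  semigroup_contr : forall (t : R) f, 0 <= t -> ip (T t f) (T t f) <= ip f f;
  semigroup_cont : forall f (e : R), 0 < e -> exists2 d, 0 < d &
    forall t, 0 <= t <= d -> ipnorm (T t f - f) < e }.

Variable T : R -> V -> V.
Hypothesis T_semi : symm_semigroup T.

Let T0 := semigroup0 T_semi.
Let TM := semigroupM T_semi.

Lemma semigroup_sym (t : R) f g : 0 <= t -> ip (T t f) g = ip f (T t g).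
Proof. by move=> t0; rewrite -(T0 f) TM// add0r. Qed.

Lemma semigroupMw (s t : R) f g : 0 <= s -> 0 <= t ->
  ip (T s (T t f)) g = ip (T (s + t) f) g.
Proof.
by move=> s0 t0; rewrite semigroup_sym// TM// addrC.
Qed.

Lemma ipnorm_contr (t : R) f : 0 <= t -> ipnorm (T t f) <= ipnorm f.
Proof. by move=> t0; rewrite ler_wsqrtr// semigroup_contr. Qed.

Lemma ipnorm_semigroup_sqr (t : R) f : 0 <= t -> ipnorm (T t f) ^+ 2 = ip (T (t + t) f) f.
Proof. by move=> t0; rewrite ipnorm_sqr TM. Qed.

Lemma ipnormM (s t : R) f : 0 <= s -> 0 <= t ->
  ipnorm (T s (T t f)) = ipnorm (T (s + t) f).
Proof. by move=> s0 t0; apply: eq_ipnorm => h; exact: semigroupMw. Qed.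

Lemma ipnorm_semigroup_le (s t : R) f : 0 <= s -> s <= t ->
  ipnorm (T t f) <= ipnorm (T s f).
Proof.
move=> s0 st; rewrite -(subrK s t) -ipnormM ?subr_ge0//.
by rewrite ipnorm_contr ?subr_ge0.
Qed.

Lemma ip_semigroup_le (s t : R) f : 0 <= s -> s <= t -> ip (T t f) f <= ip (T s f) f.
Proof.
move=> s0 st; rewrite (splitr t) (splitr s) -!ipnorm_semigroup_sqr; try lra.
by rewrite ler_pXn2r ?nnegrE// ipnorm_semigroup_le//; lra.
Qed.

Lemma ipnorm_semigroupB (t : R) f g : 0 <= t ->
  ipnorm (T t f - T t g) = ipnorm (T t (f - g)).
Proof.
move=> t0; apply: eq_ipnorm => h.
by rewrite ipBl !semigroup_sym// ipBl.
Qed.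

Lemma ipnorm_semigroup_logconvex (t : R) f : 0 <= t ->
  ipnorm (T t f) ^+ 2 <= ipnorm (T (t + t) f) * ipnorm f.
Proof. by move=> t0; rewrite ipnorm_semigroup_sqr//; exact: ip_le_norm. Qed.

Definition decays (eps : R) (f : V) :=
  forall t : R, 0 <= t -> ipnorm (T t f) <= ipnorm f * expR (- eps * t).

(** By log-convexity, the ratio r(t) = |T_t f| / (|f| e^(- eps t)) satisfies
    r(t)^2 <= r(2t).  If r(t) > 1 then r(2^n t) >= r(t)^(2^n) is unbounded in n,
    whereas r is bounded by C / |f|. *)
Lemma decays_boost (eps C : R) f :
  (forall t : R, 0 <= t -> ipnorm (T t f) <= C * expR (- eps * t)) -> decays eps f.
Proof.
move=> HC t t0.
have [f0|f0] := eqVneq (ipnorm f) 0.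
  by rewrite f0 mul0r -f0 ipnorm_contr.
have fp : 0 < ipnorm f by rewrite lt_def f0 ipnorm_ge0.
pose r s := ipnorm (T s f) / (ipnorm f * expR (- eps * s)).
have rp s : 0 < ipnorm f * expR (- eps * s) by rewrite mulr_gt0// expR_gt0.
suff: r t <= 1 by rewrite ler_pdivrMr// mul1r.
have r0 s : 0 <= r s by rewrite divr_ge0// ltW.
have r2 s : 0 <= s -> r s ^+ 2 <= r (s + s).
  move=> s0; rewrite /r mulrDr expRD expr_div_n.
  rewrite ler_pdivrMr; last by rewrite exprn_gt0.
  apply: le_trans (ipnorm_semigroup_logconvex _ s0) _.
  have := expR_gt0 (- eps * s); set x := expR _ => x0.
  rewrite le_eqVlt; apply/orP; left; apply/eqP; field.
  by rewrite f0 gt_eqF.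
have rC s : 0 <= s -> r s <= C / ipnorm f.
  move=> s0; rewrite ler_pdivrMr// mulrA divfK//; exact: HC.
have rn n : r t ^+ (2 ^ n) <= C / ipnorm f.
  have [m [m0 +]] : exists m, 0 <= m /\ r t ^+ (2 ^ n) <= r m; last first.
    by move/le_trans; apply; exact: rC.
  elim: n => [|n [m [m0 IH]]]; first by exists t; rewrite expr1.
  exists (m + m); split; first exact: addr_ge0.
  rewrite expnSr exprM (le_trans _ (r2 _ m0))//.
  by rewrite ler_pXn2r ?nnegrE ?exprn_ge0.
rewrite leNgt; apply/negP => r1.
have d0 : 0 < r t - 1 by rewrite subr_gt0.
have [n Hn] : exists n : nat, C / ipnorm f < (r t - 1) *+ n.
  have [n Hn] := exists_nat_gt (C / ipnorm f / (r t - 1)).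
  by exists n; move: Hn; rewrite ltr_pdivrMr// mulr_natl.
(* Bernoulli: r(t)^(2^n) >= 2^n (r(t) - 1) > n (r(t) - 1). *)
have := rn n; apply/negP; rewrite -ltNge (lt_le_trans Hn)//.
apply: (@le_trans _ _ ((r t - 1) *+ (2 ^ n))).
  by rewrite ler_pMn2l // ltnW // ltn_expl.
move: (2 ^ n)%N => m; rewrite -[r t in leRHS](subrK 1).
have : 0 <= r t - 1 by exact: ltW.
move: (r t - 1) => x x0; elim: m => [|m IH]; first by rewrite mulr0n expr0.
rewrite exprS mulrS; have : 1 <= (x + 1) ^+ m by rewrite exprn_ege1// lerDr.
move: IH; set y := (x + 1) ^+ m; set z := x *+ m; nra.
Qed.

Lemma decays_closed (eps : R) f :
  (forall e, 0 < e -> exists2 g, decays eps g & ipnorm (f - g) < e) ->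
  0 <= eps -> decays eps f.
Proof.
move=> H eps0 t t0.
apply/ler_addgt0Pr => e e0.
have [|g dg fg] := H (e / 2); first by lra.
have E1 : expR (- eps * t) <= 1 by rewrite -expR0 ler_expR mulNr oppr_le0 mulr_ge0.
have := expR_ge0 (- eps * t).
have E2 : ipnorm (T t f) <= ipnorm (T t g) + ipnorm (f - g).
  have -> : ipnorm (T t f) = ipnorm (T t g + T t (f - g)).
    apply: eq_ipnorm => h; rewrite ipDl !semigroup_sym// ipBl.
    by rewrite addrC subrK.
  by rewrite (le_trans (ler_ipnormD _ _))// lerD2l ipnorm_contr.
have E3 : ipnorm g <= ipnorm f + ipnorm (f - g).
  by rewrite -[g in leLHS](subKr f) ler_ipnormB.
have := dg _ t0.
move: (expR _) E1 => x x1 Hx x0.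
move: E2 Hx E3 fg; have := ipnorm_ge0 f.
move: (ipnorm _) (ipnorm _) (ipnorm _) (ipnorm _) (ipnorm _) => a b c d ff; nra.
Qed.

(** * The generator and exponential decay *)

Definition is_gen (f g : V) := forall e : R, 0 < e -> exists2 d, 0 < d &
  forall t, 0 < t <= d -> ipnorm (t^-1 *: (T t f - f) - g) < e.

Lemma is_gen_semigroup (s : R) f g : 0 <= s -> is_gen f g -> is_gen (T s f) (T s g).
Proof.
move=> s0 fg e e0; have [d d0 H] := fg e e0; exists d => // t td.
apply: le_lt_trans (H t td).
have t0 : 0 <= t by case/andP : td => /ltW.
apply: le_trans (ipnorm_contr _ s0).
rewrite le_eqVlt; apply/orP; left; apply/eqP.
apply: eq_ipnorm => h.
rewrite semigroup_sym// !(ipBl, ipZl) -!semigroup_sym// !semigroupMw//.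
by rewrite (addrC s).
Qed.

Lemma is_genZ (c : R) f g : is_gen f g -> is_gen (c *: f) (c *: g).
Proof.
move=> fg e e0; have c0 : 0 < `|c| + 1 by rewrite ltr_wpDl.
have [d d0 H] := fg _ (divr_gt0 e0 c0); exists d => // t td.
have t0 : 0 <= t by case/andP : td => /ltW.
have -> : ipnorm (t^-1 *: (T t (c *: f) - c *: f) - c *: g) =
    ipnorm (c *: (t^-1 *: (T t f - f) - g)).
  apply: eq_ipnorm => h.
  by rewrite !(ipBl, ipZl) !semigroup_sym// ipZl; ring.
rewrite ipnormZ (@le_lt_trans _ _ ((`|c| + 1) * ipnorm (t^-1 *: (T t f - f) - g)))//.
  by rewrite ler_wpM2r// lerDl.
by rewrite mulrC -ltr_pdivlMr// H.
Qed.

Lemma expRN_le (x : R) : 0 <= x -> expR (- x) <= (1 + x)^-1.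
Proof.
move=> x0; rewrite expRN lef_pV2 ?posrE ?expR_gt0 ?expR_ge1Dx//.
by rewrite ltr_pwDl.
Qed.

(** The difference quotient of t |-> <T_t f, f> = |T_(t/2) f|^2 at 0 converges to
    <g, f>, and decay bounds it by |f|^2 (e^(- eps t) - 1) / t. *)
Lemma decays_gen (eps : R) f g : 0 <= eps -> decays eps f -> is_gen f g ->
  eps * ip f f <= - ip f g.
Proof.
move=> eps0 df fg.
apply: (@ler_addgt0M _ _ _ (ip f f * eps ^+ 2 + ipnorm f)).
  by rewrite addr_ge0// mulr_ge0 ?sqr_ge0.
move=> e e0; have [d d0 H] := fg e e0.
pose t := Num.min d e.
have t0 : 0 < t by rewrite lt_min d0.
have te : t <= e by rewrite ge_min lexx orbT.
have td : t <= d by rewrite ge_min lexx.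
have := H t; rewrite t0 td => /(_ isT).
set u := t^-1 *: (T t f - f) => ug.
have H1 : ip g f <= ip u f + e * ipnorm f.
  rewrite -lerBlDl -ipBl (le_trans (ip_le_norm _ _))//.
  by rewrite ipnormB ler_wpM2r// ltW.
have H2 : ip (T t f) f <= ip f f * (1 + eps * t)^-1.
  have t20 : 0 <= t / 2 by rewrite divr_ge0// ltW.
  rewrite (splitr t) -ipnorm_semigroup_sqr// -splitr.
  apply: (@le_trans _ _ ((ipnorm f * expR (- eps * (t / 2))) ^+ 2)).
    by rewrite ler_pXn2r ?nnegrE ?mulr_ge0 ?expR_ge0 ?df.
  rewrite exprMn ipnorm_sqr ler_wpM2l// expr2 -expRD.
  rewrite (_ : _ + _ = - (eps * t)); last by field.
  by rewrite expRN_le// mulr_ge0// ltW.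
have H3 : ip u f <= - (eps * ip f f) + e * (ip f f * eps ^+ 2).
  rewrite ipZl ipBl ler_pdivrMl//.
  apply: (@le_trans _ _ (ip f f * (1 + eps * t)^-1 - ip f f)).
    by rewrite lerD2r.
  have [q0 et] : 0 <= ip f f /\ 0 <= eps * t.
    by split => //; rewrite mulr_ge0// ltW.
  rewrite -[X in _ - X]mulr1 -mulrBr.
  rewrite (_ : _^-1 - 1 = - (t * eps) / (1 + eps * t)); last first.
    by field; rewrite gt_eqF// ltr_pwDl.
  rewrite mulrA ler_pdivrMr ?ltr_pwDl//.
  have : t <= e by []. 
  move: q0 et; set q := ip f f => q0 et tt.
  have : 0 <= q * eps ^+ 2 * t * (e - t).
    by rewrite !mulr_ge0 ?sqr_ge0 ?subr_ge0 ?(ltW t0).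
  have : 0 <= q * eps ^+ 3 * t * t * e.
    by rewrite !mulr_ge0 ?exprn_ge0 ?(ltW t0) ?(ltW e0).
  lra.
rewrite (ipC' f g); lra.
Qed.

(** The function t |-> <T_t f, f> is convex, so its decrease over [0, 2h] is at
    least 2h times its rate of decrease at 2h, which is - <T_h f, L T_h f>.
    Convexity is only used along the grid of step dl = 2h / n: the second difference of
    a k = <T_(k dl) f, f> is the square of a norm. *)
Lemma gen_decay_step (eta h : R) f g : 0 <= h -> is_gen f g ->
  (forall f g : V, is_gen f g -> eta * ip f f <= - ip f g) ->
  ip (T h f) (T h f) * (1 + eta * h *+ 2) <= ip f f.
Proof.
rewrite le_eqVlt => /predU1P[<- _ _|h0 fg Heta].
  by rewrite TM// addr0 T0 mulr0 mul0rn addr0 mulr1.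
set w := T h f.
have wgen : is_gen w (T h g) by apply: is_gen_semigroup => //; exact: ltW.
apply: (@ler_addgt0M _ _ _ (2 * h * ipnorm w)).
  by rewrite !mulr_ge0// ltW.
move=> e e0; have [d d0 H] := wgen e e0.
have [n Hn] := exists_nat_gt (2 * h / d).
have n0 : 0 < n%:R :> R.
  by rewrite (le_lt_trans _ Hn)// divr_ge0 ?(ltW d0)// mulr_ge0// ltW.
pose dl := 2 * h / n%:R.
have dl0 : 0 < dl by rewrite divr_gt0// mulr_gt0.
have dld : dl <= d by rewrite ler_pdivrMr// (mulrC d) -ler_pdivrMr// ltW.
pose a k := ip (T (k%:R * dl) f) f.
have k0 k : 0 <= k%:R * dl by rewrite mulr_ge0// ltW.
have dconv k : a k.+1 - a k.+2 <= a k - a k.+1.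
  rewrite -subr_ge0.
  suff -> : a k - a k.+1 - (a k.+1 - a k.+2)
     = ip (T (k%:R * dl / 2) (T dl f - f)) (T (k%:R * dl / 2) (T dl f - f)).
    exact: ip_ge0'.
  have E u v h' : ip (T (k%:R * dl) (u - v)) h' =
      ip (T (k%:R * dl) u) h' - ip (T (k%:R * dl) v) h'.
    by rewrite !semigroup_sym// ipBl.
  rewrite TM ?divr_ge0// -splitr E !ipBr !semigroupMw ?(ltW dl0)//.
  rewrite !TM ?addr_ge0 ?(ltW dl0)// /a.
  rewrite (_ : k.+2%:R * dl = k%:R * dl + dl + dl); last by rewrite -!natr1; ring.
  rewrite (_ : k.+1%:R * dl = k%:R * dl + dl); last by rewrite -!natr1; ring.
  by ring.
have dmono j k : (j <= k)%N -> a k - a k.+1 <= a j - a j.+1.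
  move=> jk; rewrite -(subnK jk); elim: (k - j)%N => [//|m IH].
  by rewrite addSn (le_trans (dconv _)).
have atele m : (m <= n)%N -> (a n - a n.+1) *+ m <= a 0%N - a m.
  elim: m => [_|m IH mn]; first by rewrite mulr0n subrr.
  rewrite mulrS (le_trans (lerD (dmono m n (ltnW mn)) (IH (ltnW mn))))//.
  by rewrite addrC subrKA.
have := atele n (leqnn n).
have ndl : n%:R * dl = h + h by rewrite /dl mulrC divfK ?gt_eqF//; ring.
have wf : ip (T (h + h) f) f = ip w w by rewrite TM// ltW.
have -> : a 0%N = ip f f by rewrite /a mul0r T0.
have -> : a n.+1 = ip (T dl w) w.
  rewrite /a /w semigroupMw ?(ltW dl0) ?(ltW h0)// TM ?addr_ge0 ?(ltW dl0) ?(ltW h0)//.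
  by rewrite -natr1 mulrDl mul1r ndl; congr (ip (T _ _) _); ring.
have -> : a n = ip w w by rewrite /a ndl.
have := H dl; rewrite dl0 dld => /(_ isT) wg.
have : dl * (eta * ip w w - e * ipnorm w) <= ip w w - ip (T dl w) w.
  rewrite -ler_pdivlMl//.
  have -> : dl^-1 * (ip w w - ip (T dl w) w) = - ip (dl^-1 *: (T dl w - w)) w.
    by rewrite ipZl ipBl; ring.
  have := Heta _ _ wgen; rewrite (ipC' _ (T h g)) => H1.
  have : ip (dl^-1 *: (T dl w - w)) w - ip (T h g) w <= e * ipnorm w.
    by rewrite -ipBl (le_trans (ip_le_norm _ _))// ler_wpM2r// ltW.
  by move: H1; lra.
move=> H1 H2.
have : (dl * (eta * ip w w - e * ipnorm w)) * n%:R <= ip f f - ip w w.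
  by rewrite (le_trans _ H2)// -[leRHS]mulr_natr ler_wpM2r// ltW.
rewrite mulrAC (mulrC dl) ndl -mulr_natr; lra.
Qed.

(** Iterating [gen_decay_step] n times with step t / n gives
    |T_t f|^2 (1 + 2 eta t / n)^n <= |f|^2, and the power tends to
    e^(2 eta t). *)
Lemma gen_decays (eta : R) f g : 0 <= eta -> is_gen f g ->
  (forall f g : V, is_gen f g -> eta * ip f f <= - ip f g) -> decays eta f.
Proof.
move=> eta0 fg Heta t t0.
set x := 2 * eta * t.
have x0 : 0 <= x by rewrite !mulr_ge0.
suff H : ip (T t f) (T t f) * expR x <= ip f f.
  rewrite -(@ler_pXn2r _ 2) ?nnegrE ?mulr_ge0 ?expR_ge0// exprMn !ipnorm_sqr//.
  rewrite expr2 -expRD (_ : _ + _ = - x); last by rewrite /x; ring.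
  by rewrite expRN ler_pdivlMr ?expR_gt0.
apply: (@ler_addgt0M _ _ _ (ip (T t f) (T t f) * expR x * x ^+ 2)).
  by rewrite !mulr_ge0 ?expR_ge0 ?exprn_ge0.
move=> e e0.
have [n Hn] := exists_nat_gt (e^-1).
have n0 : 0 < n%:R :> R by rewrite (lt_trans _ Hn)// invr_gt0.
pose h := t / n%:R.
have h0 : 0 <= h by rewrite divr_ge0// ltW.
set y := x / n%:R.
have y0 : 0 <= y by rewrite divr_ge0// ltW.
have yE : eta * h *+ 2 = y by rewrite /y /h /x -mulr_natr; ring.
have iter k : ip (T (k%:R * h) f) (T (k%:R * h) f) * (1 + y) ^+ k <= ip f f.
  elim: k => [|k IH]; first by rewrite mul0r T0 ipC' T0 expr0 mulr1.
  apply: le_trans IH; have kh i : 0 <= i%:R * h by rewrite mulr_ge0.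
  have := gen_decay_step h0 (is_gen_semigroup (kh k) fg) Heta.
  rewrite !TM ?semigroupMw ?addr_ge0// yE.
  have -> : h + h + k%:R * h + k%:R * h = k.+1%:R * h + k.+1%:R * h.
    by rewrite -natr1; ring.
  by rewrite exprS mulrA => /ler_wpM2r; apply; rewrite exprn_ge0// addr_ge0.
have nh : n%:R * h = t by rewrite /h mulrC divfK ?gt_eqF.
have := iter n; rewrite nh => Hit.
(* From 1 + y >= e^(y / (1 + y)) and n y / (1 + y) >= x - x^2 / n, where
   n y = x and 1 / n < e. *)
have key : expR x * (1 - e * x ^+ 2) <= (1 + y) ^+ n.
  have y1 : 0 < 1 + y by rewrite ltr_pwDl.
  apply: (@le_trans _ _ (expR (y / (1 + y)) ^+ n)); last first.
    rewrite ler_pXn2r ?nnegrE ?expR_ge0 ?(ltW y1)//; last by rewrite -(ltr0n R).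
    rewrite -[leLHS]invrK -[leRHS]invrK lef_pV2 ?posrE ?invr_gt0 ?expR_gt0//.
    rewrite -expRN (le_trans _ (expR_ge1Dx _))// le_eqVlt; apply/orP; left.
    by apply/eqP; field; rewrite gt_eqF.
  rewrite -expRM_natl.
  apply: (@le_trans _ _ (expR x * expR (- (x ^+ 2 / n%:R)))).
    rewrite ler_wpM2l ?expR_ge0// (le_trans _ (expR_ge1Dx _))// lerD2l lerN2.
    rewrite mulrC ler_wpM2r ?sqr_ge0// -[leRHS]invrK lef_pV2 ?posrE ?invr_gt0//.
    exact: ltW.
  rewrite -expRD ler_expR.
  have -> : n%:R * (y / (1 + y)) = x / (1 + y).
    by rewrite mulrA [n%:R * y]mulrC divfK ?gt_eqF.
  have -> : x ^+ 2 / n%:R = x * y by rewrite /y; ring.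
  rewrite ler_pdivlMr//.
  have : 0 <= x * y ^+ 2 by rewrite mulr_ge0 ?sqr_ge0.
  by lra.
have q0 := ip_ge0' (T t f).
have := ler_wpM2l q0 key.
move: Hit; set q := ip (T t f) _; set X := expR x; lra.
Qed.

(** * Means along orbits *)

(** The Riemann sum of the integral of r |-> T_r f over [0, 1]. *)
Definition riemann_mean (n : nat) (f : V) : V :=
  n%:R^-1 *: \sum_(0 <= k < n) T (k%:R / n%:R) f.

Lemma ipnorm_sum_le (m : nat) (F : nat -> V) (c : R) :
  (forall k, (k < m)%N -> ipnorm (F k) <= c) ->
  ipnorm (\sum_(0 <= k < m) F k) <= m%:R * c.
Proof.
move=> H; apply: le_trans (ler_ipnorm_sum _ _ _) _.
rewrite big_nat_cond (le_trans (ler_sum _ (G := fun=> c) _))//.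
  by move=> i /andP[/andP[_ im] _]; exact: H.
by rewrite -big_nat_cond sumr_const_nat subn0 mulr_natl.
Qed.

Lemma ipnorm_mean_le (n : nat) (F : nat -> V) (c : R) : (0 < n)%N ->
  (forall k, (k < n)%N -> ipnorm (F k) <= c) ->
  ipnorm (n%:R^-1 *: \sum_(0 <= k < n) F k) <= c.
Proof.
move=> n0 H; rewrite ipnormZ ger0_norm ?invr_ge0//.
by rewrite ler_pdivrMl ?ltr0n// ipnorm_sum_le.
Qed.

Lemma ipnorm_semigroup_incr (a r : R) f : 0 <= a -> 0 <= r ->
  ipnorm (T (a + r) f - T a f) <= ipnorm (T r f - f).
Proof.
move=> a0 r0; apply: le_trans (ipnorm_contr _ a0).
rewrite -ipnorm_semigroupB// le_eqVlt; apply/orP; left; apply/eqP.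
by apply: eq_ipnorm => h; rewrite !ipBl semigroupMw.
Qed.

(** Each node k / (N M) of the fine subdivision is compared with the node of the
    coarse one to its left, at distance at most 1 / N. *)
Lemma riemann_mean_refine (N M : nat) f (w : R) : (0 < N)%N -> (0 < M)%N ->
  (forall r, 0 <= r <= N%:R^-1 -> ipnorm (T r f - f) <= w) ->
  ipnorm (riemann_mean (N * M) f - riemann_mean N f) <= w.
Proof.
move=> N0 M0 H.
have NR : N%:R != 0 :> R by rewrite pnatr_eq0 -lt0n.
have MR : M%:R != 0 :> R by rewrite pnatr_eq0 -lt0n.
have -> : riemann_mean N f = (N * M)%:R^-1 *:
    \sum_(0 <= k < N * M) T ((k %/ M)%:R / N%:R) f.
  rewrite big_nat_mul /riemann_mean.
  under [in RHS]eq_big_nat => i _.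
    under eq_big_nat => j /andP[ij ji].
      have -> : (j %/ M = i)%N.
        by apply/eqP; rewrite eqn_leq leq_divRL// ij andbT -ltnS ltn_divLR.
      over.
    rewrite sumr_const_nat mulSnr addKn; over.
  rewrite sumrMnl -[X in _ = _ *: X]scaler_nat scalerA natrM; congr (_ *: _).
  by field; rewrite ?NR ?MR.
rewrite /riemann_mean -scalerBr -sumrB ipnorm_mean_le ?muln_gt0 ?N0//.
move=> k kNM.
have -> : k%:R / (N * M)%:R = (k %/ M)%:R / N%:R + (k %% M)%:R / (N * M)%:R :> R.
  by rewrite [in LHS](divn_eq k M) natrD !natrM; field; rewrite ?NR ?MR.
have r0 : 0 <= (k %% M)%:R / (N * M)%:R :> R by rewrite divr_ge0.
rewrite (le_trans (ipnorm_semigroup_incr _ _ r0)) ?divr_ge0// H// r0/=.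
rewrite natrM invfM mulrCA ler_piMr ?invr_ge0//.
by rewrite ler_pdivrMr ?ltr0n// mul1r ler_nat ltnW// ltn_mod.
Qed.

(** Two subdivisions are compared through their common refinement. *)
Lemma riemann_mean_cauchy f (e : R) : 0 < e ->
  exists N0, forall n m, (N0 <= n)%N -> (N0 <= m)%N ->
    ipnorm (riemann_mean n.+1 f - riemann_mean m.+1 f) < e.
Proof.
move=> e0; have [|d d0 Hd] := semigroup_cont T_semi f (e := e / 3).
  by rewrite divr_gt0.
have [N0 HN0] := exists_nat_gt d^-1; exists N0 => n m n0 m0.
have small k : (N0 <= k)%N ->
    forall r, 0 <= r <= k.+1%:R^-1 -> ipnorm (T r f - f) <= e / 3.
  move=> k0 r /andP[r0 rk]; apply/ltW/Hd; rewrite r0/= (le_trans rk)//.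
  rewrite -[leRHS]invrK lef_pV2 ?posrE ?invr_gt0//.
  by rewrite (le_trans (ltW HN0))// ler_nat leqW.
have H1 := riemann_mean_refine (ltn0Sn n) (ltn0Sn m) (small n n0).
have H2 := riemann_mean_refine (ltn0Sn m) (ltn0Sn n) (small m m0).
rewrite mulnC in H2; rewrite ipnormB in H1.
have := ler_ipnormD (riemann_mean n.+1 f - riemann_mean (n.+1 * m.+1) f)
  (riemann_mean (n.+1 * m.+1) f - riemann_mean m.+1 f).
rewrite subrKA; lra.
Qed.

Lemma ip_riemann_mean n (s : R) f h : 0 <= s ->
  ip (T s (riemann_mean n f)) h =
  n%:R^-1 * \sum_(0 <= k < n) ip (T (s + k%:R / n%:R) f) h.
Proof.
move=> s0; rewrite semigroup_sym// ipZl ip_suml; congr (_ * _).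
by apply: eq_bigr => k _; rewrite -semigroup_sym// semigroupMw ?divr_ge0.
Qed.

Definition converges (u : nat -> V) (l : V) := forall e : R, 0 < e ->
  exists N0, forall n, (N0 <= n)%N -> ipnorm (u n - l) < e.

(** For a multiple s = m / n of the mesh, T_s shifts the subdivision, and the
    difference telescopes: only the first m terms, moved by 1, remain. *)
Lemma riemann_mean_shift n m f : (0 < n)%N ->
  forall s, s = m%:R / n%:R ->
  ipnorm (T s (riemann_mean n f) - riemann_mean n f - s *: (T 1 f - f)) =
  ipnorm (n%:R^-1 *: \sum_(0 <= k < m)
     (T (k%:R / n%:R) (T 1 f - f) - (T 1 f - f))).
Proof.
move=> n0 s sE; have s0 : 0 <= s by rewrite sE divr_ge0.
apply: eq_ipnorm => h; rewrite 2!ipBl -(T0 (riemann_mean n f)).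
rewrite !ip_riemann_mean// (ipZl s) (ipZl n%:R^-1) ip_suml ipBl.
pose phi (k : nat) := ip (T (k%:R / n%:R) f) h.
have E1 : \sum_(0 <= k < n) ip (T (s + k%:R / n%:R) f) h =
    \sum_(0 <= k < n) phi (m + k)%N.
  by apply: eq_bigr => k _; rewrite /phi sE natrD mulrDl.
have E2 : \sum_(0 <= k < n) ip (T (0 + k%:R / n%:R) f) h =
    \sum_(0 <= k < n) phi k.
  by apply: eq_bigr => k _; rewrite add0r.
have nR : n%:R != 0 :> R by rewrite pnatr_eq0 -lt0n.
have E3 : \sum_(0 <= k < m) ip (T (k%:R / n%:R) (T 1 f - f) - (T 1 f - f)) h =
    \sum_(0 <= k < m) phi (n + k)%N - \sum_(0 <= k < m) phi k
      - (ip (T 1 f) h - ip f h) *+ m.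
  rewrite (_ : _ *+ m = \sum_(0 <= k < m) (ip (T 1 f) h - ip f h)); last first.
    by rewrite sumr_const_nat subn0.
  rewrite -!sumrB.
  apply: eq_bigr => k _; have kn : 0 <= k%:R / n%:R :> R by rewrite divr_ge0.
  rewrite !ipBl semigroup_sym// ipBl -!semigroup_sym// semigroupMw//.
  by rewrite /phi natrD mulrDl divff// (addrC 1).
have E4 : \sum_(0 <= k < n) phi (m + k)%N + \sum_(0 <= k < m) phi k =
    \sum_(0 <= k < m) phi (n + k)%N + \sum_(0 <= k < n) phi k.
  have split_sum i j : \sum_(0 <= k < j) phi (i + k)%N + \sum_(0 <= k < i) phi k
      = \sum_(0 <= k < i + j) phi k.
    rewrite (@big_cat_nat _ _ _ i 0 (i + j))//= ?leq_addr// addrC; congr (_ + _).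
    rewrite -[in RHS](add0n i) big_addn addKn.
    by apply: eq_bigr => k _; rewrite addnC.
  by rewrite !split_sum addnC.
rewrite E1 E2 E3 sE -mulr_natr; move: E4; set A := \sum_(_ <= _ < _) _.
by move=> /(canRL (addrK _)) ->; field; rewrite ?nR.
Qed.

(** The discrete form of (T_t - 1) int_0^1 T_r f dr = int_0^t T_r (T_1 f - f) dr.
    A real time t is rounded down to a multiple s of the mesh, and the rounding
    error is controlled by strong continuity at f. *)
Lemma riemann_mean_gen f G : converges (fun n => riemann_mean n.+1 f) G ->
  is_gen G (T 1 f - f).
Proof.
move=> fG; set w := T 1 f - f => e e0.
have e20 : 0 < e / 2 by rewrite divr_gt0.
have [d d0 Hd] := semigroup_cont T_semi w e20.
exists d => // t /andP[t0 td].
suff H : ipnorm (T t G - G - t *: w) <= t * (e / 2).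
  have -> : t^-1 *: (T t G - G) - w = t^-1 *: (T t G - G - t *: w).
    by rewrite [in RHS]scalerBr scalerA mulVf ?gt_eqF// scale1r.
  rewrite ipnormZ gtr0_norm ?invr_gt0// ltr_pdivrMl// (le_lt_trans H)//.
  by rewrite ltr_pM2l//; lra.
apply: (@ler_addgt0M _ _ _ (3 + ipnorm w)); first by rewrite addr_ge0.
move=> e' e'0.
have [N1 HN1] := fG _ e'0.
have [d' d'0 Hd'] := semigroup_cont T_semi f e'0.
have [N2 HN2] := exists_nat_gt (d'^-1 + e'^-1).
pose n := maxn N1 N2; pose g := riemann_mean n.+1 f.
have gG : ipnorm (g - G) < e' by apply: HN1; rewrite leq_maxl.
have nR : 0 < n.+1%:R :> R by rewrite ltr0n.
have [nd' ne'] : n.+1%:R^-1 <= d' /\ n.+1%:R^-1 <= e'.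
  have : d'^-1 + e'^-1 <= n.+1%:R.
    by rewrite (le_trans (ltW HN2))// ler_nat leqW// leq_maxr.
  move=> H; split.
    rewrite -[leRHS]invrK lef_pV2 ?posrE ?invr_gt0// (le_trans _ H)//.
    by rewrite lerDl invr_ge0 ltW.
  rewrite -[leRHS]invrK lef_pV2 ?posrE ?invr_gt0// (le_trans _ H)//.
  by rewrite lerDr invr_ge0 ltW.
pose m := Num.truncn (t * n.+1%:R).
pose s : R := m%:R / n.+1%:R.
have s0 : 0 <= s by rewrite divr_ge0.
have /andP[st ts] : s <= t < s + n.+1%:R^-1.
  have /andP[H1 H2] := @Num.Theory.truncn_itv _ (t * n.+1%:R) (mulr_ge0 (ltW t0) (ltW nR)).
  rewrite /s ler_pdivrMr// H1/= -[X in _ + X]mul1r -mulrDl natr1.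
  by rewrite ltr_pdivlMr.
have rho0 : 0 <= t - s by rewrite subr_ge0.
have B1 : ipnorm (T t G - T t g) <= e'.
  rewrite (ipnorm_semigroupB _ _ (ltW t0)) (le_trans (ipnorm_contr _ (ltW t0)))//.
  by rewrite ipnormB ltW.
have B2 : ipnorm (T t g - T s g) <= e'.
  rewrite -[t in T t g](subrKC s) (le_trans (ipnorm_semigroup_incr _ s0 rho0))//.
  have -> : ipnorm (T (t - s) g - g) = ipnorm (n.+1%:R^-1 *:
     \sum_(0 <= k < n.+1) (T (t - s + k%:R / n.+1%:R) f - T (k%:R / n.+1%:R) f)).
    apply: eq_ipnorm => h; rewrite ipBl -(T0 g) !ip_riemann_mean//.
    rewrite ipZl ip_suml -mulrBr -sumrB; congr (_ * _).
    by apply: eq_bigr => k _; rewrite ipBl add0r.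
  apply: ipnorm_mean_le => // k _; rewrite [t - s + _]addrC.
  rewrite (le_trans (ipnorm_semigroup_incr _ _ rho0)) ?divr_ge0//.
  by apply/ltW/Hd'; rewrite rho0/= (le_trans _ nd')// lerBlDl ltW.
have B3 : ipnorm (T s g - g - s *: w) <= t * (e / 2).
  rewrite (@riemann_mean_shift _ m)//.
  rewrite ipnormZ gtr0_norm ?invr_gt0// ler_pdivrMl//.
  apply: le_trans (ipnorm_sum_le (c := e / 2) _) _.
    move=> k km; apply/ltW/Hd; rewrite divr_ge0//= (le_trans _ td)//.
    by rewrite (le_trans _ st)// /s ler_wpM2r ?invr_ge0// ler_nat ltnW.
  rewrite [leRHS]mulrA ler_wpM2r ?(ltW e20)//.
  by move: st; rewrite /s ler_pdivrMr// mulrC.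
have B4 : ipnorm ((s - t) *: w) <= e' * ipnorm w.
  by rewrite ipnormZ ler_wpM2r// distrC ger0_norm// (le_trans _ ne')// lerBlDl ltW.
have -> : T t G - G - t *: w = (T t G - T t g) + (g - G) + (T t g - T s g) +
    (T s g - g - s *: w) + (s - t) *: w.
  rewrite scalerBl.
  move: (T t G) (T t g) (T s g) (s *: w) (t *: w) => a b c x y.
  rewrite (addrAC (a - b)) subrKA (addrAC (a - c)) -(addrA c) subrKA.
  by rewrite (addrC (- g)) (addrA a) subrKA (addrAC (a - x)) subrKA addrAC.
have tri a b x y : ipnorm a <= x -> ipnorm b <= y -> ipnorm (a + b) <= x + y.
  by move=> ax bY; rewrite (le_trans (ler_ipnormD _ _))// lerD.
apply: le_trans (tri _ _ _ _ (tri _ _ _ _ (tri _ _ _ _ (tri _ _ _ _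
  B1 (ltW gG)) B2) B3) B4) _; lra.
Qed.

Lemma mean_ge (n : nat) (F : nat -> R) (c : R) : (0 < n)%N ->
  (forall k, (k < n)%N -> c <= F k) -> c <= n%:R^-1 * \sum_(0 <= k < n) F k.
Proof.
move=> n0 H; rewrite ler_pdivlMl ?ltr0n//.
rewrite [leRHS]big_nat_cond.
rewrite (le_trans _ (ler_sum _ (F := fun=> c) _))//; last first.
  by move=> k /andP[/andP[_ kn] _]; exact: H.
by rewrite -big_nat_cond sumr_const_nat subn0 mulr_natl.
Qed.

(** The square of the right-hand side is a mean of terms
    <T_(2t + r + r') f, f> with r, r' <= 1, each of which is at least
    <T_(2t + 2) f, f>. *)
Lemma riemann_mean_ge (t : R) n f : (0 < n)%N -> 0 <= t ->
  ipnorm (T (t + 1) f) <= ipnorm (T t (riemann_mean n f)).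
Proof.
move=> n0 t0.
rewrite -(@ler_pXn2r _ 2) ?nnegrE// ipnorm_semigroup_sqr ?addr_ge0//.
rewrite ipnorm_semigroup_sqr// ip_riemann_mean ?addr_ge0//.
apply: mean_ge => // k kn; rewrite [leRHS]ipC' -(T0 (riemann_mean n f)).
rewrite ip_riemann_mean//; apply: mean_ge => // j jn.
have kn1 i : (i < n)%N -> i%:R / n%:R <= 1 :> R.
  by move=> i_n; rewrite ler_pdivrMr ?ltr0n// mul1r ler_nat ltnW.
rewrite add0r TM ?addr_ge0 ?divr_ge0// ip_semigroup_le ?addr_ge0 ?divr_ge0//.
by have := kn1 k kn; have := kn1 j jn; lra.
Qed.

Lemma converges_ge u G (t c : R) : 0 <= t -> converges u G ->
  (forall n, c <= ipnorm (T t (u n))) -> c <= ipnorm (T t G).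
Proof.
move=> t0 uG H; apply/ler_addgt0Pr => e /uG[N /(_ N (leqnn _)) NG].
apply: le_trans (H N) _.
have -> : ipnorm (T t (u N)) = ipnorm (T t G + T t (u N - G)).
  apply: eq_ipnorm => h; rewrite ipDl !semigroup_sym// ipBl.
  by rewrite addrC subrK.
rewrite (le_trans (ler_ipnormD _ _))// lerD2l (le_trans (ipnorm_contr _ t0))//.
exact: ltW.
Qed.

Definition is_cauchy (u : nat -> V) := forall e : R, 0 < e ->
  exists N0, forall n m, (N0 <= n)%N -> (N0 <= m)%N -> ipnorm (u n - u m) < e.

(** The spectral inequality on the domain implies decay of every vector.  The
    mean G of r |-> T_(r + a) f over [0, 1] belongs to the domain, so it decays,
    and T_(t + 1 + a) f is dominated in norm by T_t G; [decays_boost] then absorbs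
    the time shift 1 + a and the constant.  Convergence is only required of
    Cauchy sequences transformed by T_a. *)
Theorem gen_decays_all (a eta : R) : 0 <= a -> 0 <= eta ->
  (forall u, is_cauchy u -> exists G, converges (T a \o u) G) ->
  (forall f g : V, is_gen f g -> eta * ip f f <= - ip f g) ->
  forall f, decays eta f.
Proof.
move=> a0 eta0 Hcomp Heta f.
have [|G uG] := Hcomp (fun n => riemann_mean n.+1 f).
  by move=> e e0; exact: riemann_mean_cauchy.
have rG : converges (fun n => riemann_mean n.+1 (T a f)) G.
  move=> e /uG[N HN]; exists N => n /HN; apply: le_lt_trans.
  rewrite le_eqVlt; apply/orP; left; apply/eqP; apply: eq_ipnorm => h.
  rewrite !ipBl -(T0 (riemann_mean _ _)) !ip_riemann_mean//.
  congr (_ * _ - _); apply: eq_bigr => k _.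
  by rewrite semigroupMw ?addr_ge0 ?divr_ge0// add0r addrC.
have dG := gen_decays eta0 (riemann_mean_gen rG) Heta.
apply: (@decays_boost _ ((ipnorm G + ipnorm f) * expR (eta * (1 + a)))) => t t0.
rewrite -mulrA -expRD (_ : _ + - eta * t = - eta * (t - (1 + a))); last by ring.
have [ta|ta] := leP (1 + a) t.
  have t10 : 0 <= t - (1 + a) by rewrite subr_ge0.
  have E : ipnorm (T t f) = ipnorm (T (t - (1 + a) + 1) (T a f)).
    by rewrite (ipnormM _ (addr_ge0 t10 ler01) a0); congr (ipnorm (T _ f)); ring.
  rewrite E (le_trans (converges_ge t10 rG _))//.
    by move=> n; exact: riemann_mean_ge.
  rewrite (le_trans (dG _ t10))// ler_wpM2r ?expR_ge0//.
  by rewrite lerDl.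
apply: (@le_trans _ _ (ipnorm f)); first exact: ipnorm_contr.
apply: (@le_trans _ _ (ipnorm G + ipnorm f)); first by rewrite lerDr.
rewrite ler_peMr ?addr_ge0// -[leLHS]expR0 ler_expR.
have : 0 <= eta * (1 + a - t) by rewrite mulr_ge0// subr_ge0 ltW.
by lra.
Qed.

(** Both sides of the spectral inequality are continuous for the graph norm. *)
Lemma gen_core (eta : R) (C : V -> Prop) : 0 <= eta ->
  (forall f g, is_gen f g -> forall e : R, 0 < e -> exists f' g',
     [/\ C f', is_gen f' g', ipnorm (f - f') < e & ipnorm (g - g') < e]) ->
  (forall f g, C f -> is_gen f g -> eta * ip f f <= - ip f g) ->
  forall f g, is_gen f g -> eta * ip f f <= - ip f g.
Proof.
move=> eta0 Hd HC f g fg.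
apply: (@ler_addgt0M _ _ _
  (ipnorm g + ipnorm f + 1 + eta * (2 * ipnorm f + 3))).
  by rewrite !addr_ge0// mulr_ge0// addr_ge0// mulr_ge0.
(* With e1 <= 1, the norm of f' is bounded independently of e. *)
move=> e e0; pose e1 := Num.min e 1.
have e10 : 0 < e1 by rewrite lt_min e0/=.
have e1e : e1 <= e by rewrite ge_min lexx.
have e11 : e1 <= 1 by rewrite ge_min lexx orbT.
have [f' [g' [Cf' fg' ff gg]]] := Hd _ _ fg _ e10.
have H := HC _ _ Cf' fg'.
have n1 : ipnorm f' <= ipnorm f + e1.
  rewrite -[f' in leLHS](subKr f) (le_trans (ler_ipnormB _ _))// lerD2l ltW//.
have n2 : ipnorm f <= ipnorm f' + e1.
  rewrite -[f in leLHS](subrKC f') (le_trans (ler_ipnormD _ _))// lerD2l.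
  exact: ltW.
have H1 : ip f g - ip f' g' <= e1 * ipnorm g + ipnorm f' * e1.
  have -> : ip f g - ip f' g' = ip (f - f') g + ip f' (g - g').
    by rewrite ipBl ipBr; ring.
  by rewrite lerD// (le_trans (ip_le_norm _ _))// ?ler_wpM2r// ?ler_wpM2l// ltW.
rewrite -!ipnorm_sqr in H *.
have := ipnorm_ge0 f; have := ipnorm_ge0 f'; have := ipnorm_ge0 g.
move: n1 n2 H1 H; set a := ipnorm f; set b := ipnorm f'; set c := ipnorm g.
move=> n1 n2 H1 H c0 b0 a0.
have K1 : eta * a ^+ 2 <= eta * b ^+ 2 + eta * (e1 * (2 * a + 3)).
  rewrite -mulrDr ler_wpM2l//.
  have : a ^+ 2 <= (b + e1) ^+ 2 by rewrite ler_pXn2r ?nnegrE ?addr_ge0// ltW.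
  have : e1 * b <= e1 * (a + e1) by rewrite ler_wpM2l// ltW.
  have : e1 * e1 <= e1 * 1 by rewrite ler_wpM2l// ltW.
  by lra.
have K2 : b * e1 <= (a + 1) * e1 by rewrite ler_wpM2r ?(ltW e10)//; lra.
have K3 : e1 * (c + a + 1 + eta * (2 * a + 3)) <=
          e * (c + a + 1 + eta * (2 * a + 3)).
  rewrite ler_wpM2r// !addr_ge0// mulr_ge0// addr_ge0// mulr_ge0//.
by move: K3; lra.
Qed.

End SemiInner.
#[global] Hint Resolve ipnorm_ge0 : core.
(** * The space L^2 *)

Section L2.
Context d (T : measurableType d) (R : realType).
Variable mu : {measure set T -> \bar R}.

Lemma le1_2 : (1 <= 2%:E :> \bar R)%E.
Proof. by rewrite lee_fin ler1n. Qed.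

Lemma Lnorm2E (f : T -> R) :
  ('N[mu]_2%:E[EFin \o f] = ((\int[mu]_x (f x ^+ 2)%:E) `^ 2^-1))%E.
Proof.
rewrite unlock; congr (_ `^ _)%E; apply: eq_integral => x _ /=.
by rewrite powR_mulrn// real_normK// num_real.
Qed.

Lemma Lfun2P (f : T -> R) : f \in Lfun mu 2%:E <->
  measurable_fun setT f /\ (\int[mu]_x (f x ^+ 2)%:E < +oo)%E.
Proof.
split.
  move=> fL; split; first by move: fL; rewrite inE => /andP[]; rewrite inE.
  have /integrableP[_] := Lfun2_integrable_sqr fL.
  apply: le_lt_trans; rewrite le_eqVlt; apply/orP; left; apply/eqP.
  by apply: eq_integral => x _ /=; rewrite ger0_norm ?sqr_ge0.
move=> [mf fi]; rewrite inE; apply/andP; split; rewrite inE//=.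
by rewrite /finite_norm Lnorm2E poweR_lty.
Qed.

Definition L2 := LfunType mu le1_2.

Definition ip2 (f g : L2) : R := \int[mu]_x (f x * g x).

Lemma L2_Lfun (f : L2) : (f : T -> R) \in Lfun mu 2%:E.
Proof. exact: LfunP. Qed.

Lemma L2_mfun (f : L2) : measurable_fun setT (f : T -> R).
Proof. by have /Lfun2P[] := L2_Lfun f. Qed.

Lemma L2_integrableM (f g : L2) : mu.-integrable setT (EFin \o (f \* g)).
Proof. by apply/Lfun1_integrable/Lfun2_mul_Lfun1; exact: L2_Lfun. Qed.

Lemma L2_addE (f g : L2) x : (f + g) x = f x + g x. Proof. by []. Qed.
Lemma L2_scaleE (a : R) (f : L2) x : (a *: f) x = a * f x. Proof. by []. Qed.
Lemma L2_subE (f g : L2) x : (f - g) x = f x - g x. Proof. by []. Qed.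

Lemma ip2_semi : semi_inner ip2.
Proof.
split.
- by move=> f g; apply: eq_Rintegral => x _; rewrite mulrC.
- move=> a f g h; rewrite /ip2 -RintegralZl//; last exact: L2_integrableM.
  rewrite -RintegralD//; first last.
    exact: L2_integrableM.
    have := L2_integrableM (a *: f) h.
    by apply: eq_integrable => // x _; congr EFin; rewrite [RHS]mulrA.
  by apply: eq_Rintegral => x _; rewrite L2_addE L2_scaleE mulrDl mulrA.
- by move=> f; apply: Rintegral_ge0 => x _; rewrite -expr2 sqr_ge0.
Qed.

Lemma ip2_EFin (f g : L2) : ((ip2 f g)%:E = \int[mu]_x (f x * g x)%:E)%E.
Proof. by rewrite fineK//; apply: integrable_fin_num => //; exact: L2_integrableM. Qed.

Lemma ipnorm2_sqr (f : L2) : ((ipnorm ip2 f ^+ 2)%:E = \int[mu]_x (f x ^+ 2)%:E)%E.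
Proof. by rewrite (ipnorm_sqr ip2_semi) ip2_EFin; apply: eq_integral => x _. Qed.

Lemma ipnorm2E (f : L2) : ((ipnorm ip2 f)%:E = 'N[mu]_2%:E[EFin \o f])%E.
Proof.
rewrite Lnorm2E -ipnorm2_sqr poweR_EFin powR12_sqrt ?sqr_ge0//.
by rewrite sqrtr_sqr ger0_norm.
Qed.

Lemma ip2_ae_eq (f g h k : L2) : ae_eq mu setT (f : T -> R) g ->
  ae_eq mu setT (h : T -> R) k -> ip2 f h = ip2 g k.
Proof.
move=> fg hk; congr fine; apply: ae_eq_integral => //.
- by apply/measurable_EFinP/measurable_funM; exact: L2_mfun.
- by apply/measurable_EFinP/measurable_funM; exact: L2_mfun.
- by apply: filterS2 fg hk => x /= fg hk _; rewrite fg// hk.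
Qed.

(** Square-integrable functions seen as vectors; other functions give 0. *)
Definition to_L2 (f : T -> R) : L2 := insubd (0 : L2) f.

Lemma to_L2E (f : T -> R) : f \in Lfun mu 2%:E -> to_L2 f = f :> (T -> R).
Proof. by move=> fL; rewrite /to_L2 (insubdK (0 : L2) fL). Qed.

Lemma Lfun2_le (f : T -> R) (g : L2) : measurable_fun setT f ->
  (forall x, `|f x| <= `|g x|) -> f \in Lfun mu 2%:E.
Proof.
move=> mf fg; apply/Lfun2P; split => //.
have /Lfun2P[mg] := L2_Lfun g; apply: le_lt_trans; apply: ge0_le_integral => //.
- by move=> x _; rewrite lee_fin sqr_ge0.
- by apply/measurable_EFinP; exact: measurable_funX.
- by apply/measurable_EFinP; exact: measurable_funX.
move=> x _; rewrite lee_fin -[leLHS]real_normK ?num_real//.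
by rewrite -[leRHS]real_normK ?num_real// ler_pXn2r ?nnegrE.
Qed.

End L2.
Arguments to_L2 {d T R} mu f.
(** * The semigroup on nonnegative functions *)

Section Density.
Context d (T : measurableType d) (R : realType).
Variable mu : {sigma_finite_measure set T -> \bar R}.

Variable nu : {measure set T -> \bar R}.
Hypothesis nu_fin : fin_num_fun nu.

Let nu' : set T -> \bar R := nu.
HB.instance Definition _ := Measure.on nu'.
HB.instance Definition _ := Measure_isFinite.Build _ _ _ nu' nu_fin.

(** By uniqueness, p is almost everywhere the Radon-Nikodym derivative, for which
    the change of variables formula is available. *)
Lemma ge0_integral_density (p f : T -> \bar R) :
  measurable_fun setT p -> (forall x, 0 <= p x)%E ->
  (forall A, measurable A -> nu A = \int[mu]_(x in A) p x)%E ->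
  measurable_fun setT f -> (forall x, 0 <= f x)%E ->
  (\int[nu]_x f x = \int[mu]_x (p x * f x))%E.
Proof.
move=> mp p0 nup mf f0.
rewrite -[LHS]/(\int[nu']_x f x)%E.
have {}nup A : measurable A -> (nu' A = \int[mu]_(x in A) p x)%E by exact: nup.
have numu : nu' `<< mu.
  apply/null_content_dominatesP => A mA muA0; rewrite nup//.
  apply: null_set_integral => //; exact: measurable_funTS.
rewrite -(Radon_Nikodym_SigmaFinite.change_of_variables numu)//.
have ip : mu.-integrable setT p.
  apply/integrableP; split=> //; under eq_integral do rewrite gee0_abs//.
  by rewrite -nup// ltey_eq (fin_num_measure nu').
apply: ae_eq_integral => //.
- apply: emeasurable_funM => //.
  exact: measurable_int (Radon_Nikodym_SigmaFinite.f_integrable _).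
- exact: emeasurable_funM.
under [X in ae_eq _ _ _ X]eq_fun do rewrite muleC.
apply: ae_eqe_mul2l; apply: ae_eq_sym; apply: integral_ae_eq => //.
  exact: measurable_int (Radon_Nikodym_SigmaFinite.f_integrable _).
move=> A _ mA; rewrite -nup//.
exact: Radon_Nikodym_SigmaFinite.f_integral.
Qed.

End Density.

Section NonnegSemigroup.
Variables (R : realType) (E : ptopologicalType).
Variable mu : {sigma_finite_measure set (borel E) -> \bar R}.
Variable P : R -> R.-spker (borel E) ~> (borel E).
Variable p : R -> borel E -> borel E -> \bar R.
Hypothesis P_trans : transition_function P.
Hypothesis P_dens : transition_density mu P p.
Local Open Scope ereal_scope.
Implicit Types (f g : borel E -> \bar R) (t s : R).

Definition kint t f (x : borel E) : \bar R := \int[P t x]_y f y.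

Lemma kint_ge0 t f x : (forall y, 0 <= f y) -> 0 <= kint t f x.
Proof. by move=> f0; exact: integral_ge0. Qed.

Lemma measurable_kint t f : measurable_fun setT f -> (forall y, 0 <= f y) ->
  measurable_fun setT (kint t f).
Proof.
move=> mf f0; apply: measurable_fun_integral_kernel => //.
exact: measurable_kernel.
Qed.

Lemma kint0 f x : measurable_fun setT f -> kint 0 f x = f x.
Proof.
move=> mf; rewrite /kint (eq_measure_integral (\d_x)%R) => [|A mA _].
  by rewrite integral_dirac// diracT mul1e.
by have [-> //] := P_trans.
Qed.

Lemma measurable_density t x : (0 < t)%R -> measurable_fun setT (p t x).
Proof.
move=> t0; exact: measurableT_comp (density_measurable P_dens t0) (pair1_measurable x).
Qed.

Lemma kintE t f x : (0 < t)%R -> measurable_fun setT f -> (forall y, 0 <= f y) ->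
  kint t f x = \int[mu]_y (p t x y * f y).
Proof.
move=> t0 mf f0; rewrite /kint.
apply: (ge0_integral_density (finite_kernel_measure (P t) x)) => //.
- exact: measurable_density.
- exact: density_ge0 P_dens _ t0 x.
- exact: densityE P_dens _ t0 x.
Qed.

(** Tonelli's theorem and the symmetry of the density. *)
Lemma kint_sym t f g : (0 <= t)%R ->
  measurable_fun setT f -> (forall y, 0 <= f y) ->
  measurable_fun setT g -> (forall y, 0 <= g y) ->
  \int[mu]_x (kint t f x * g x) = \int[mu]_x (f x * kint t g x).
Proof.
rewrite le_eqVlt => /predU1P[<-|t0] mf f0 mg g0.
  by apply: eq_integral => x _; rewrite !kint0.
pose F (z : borel E * borel E) := f z.2 * p t z.1 z.2 * g z.1.
have p0 := density_ge0 P_dens t0.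
transitivity (\int[mu]_x \int[mu]_y F (x, y)).
  apply: eq_integral => x _; rewrite kintE// -ge0_integralZr//.
  - by apply: eq_integral => y _; rewrite /F/= (muleC (p t x y)).
  - by apply: emeasurable_funM => //; exact: measurable_density.
  - by move=> y _; rewrite mule_ge0.
rewrite fubini_tonelli.
- apply: eq_integral => y _; rewrite kintE// -ge0_integralZl//.
  + by apply: eq_integral => x _; rewrite /F/= (density_sym P_dens t0 x y) -muleA.
  + by apply: emeasurable_funM => //; exact: measurable_density.
  + by move=> x _; rewrite mule_ge0.
- apply: emeasurable_funM; last exact: measurableT_comp.
  apply: emeasurable_funM; first exact: measurableT_comp.
  exact: density_measurable P_dens _ t0.
- by move=> z; rewrite !mule_ge0.
Qed.

(** Tonelli's theorem and the Chapman-Kolmogorov identity for the density; time 0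
    has no density and is treated apart. *)
Lemma kintM s t f x : (0 <= s)%R -> (0 <= t)%R ->
  measurable_fun setT f -> (forall y, 0 <= f y) ->
  kint s (kint t f) x = kint (s + t) f x.
Proof.
move=> s0 t0 mf f0.
move: s0; rewrite le_eqVlt => /predU1P[<-|s0].
  by rewrite add0r kint0//; exact: measurable_kint.
move: t0; rewrite le_eqVlt => /predU1P[<-|t0].
  by rewrite addr0; apply: eq_integral => y _; rewrite kint0.
have p0s := density_ge0 P_dens s0; have p0t := density_ge0 P_dens t0.
rewrite !kintE ?addr_gt0//; [|exact: measurable_kint|by move=> y; exact: kint_ge0].
pose F (z : borel E * borel E) := p s x z.1 * (p t z.1 z.2 * f z.2).
transitivity (\int[mu]_y \int[mu]_z F (y, z)).
  apply: eq_integral => y _; rewrite kintE// -ge0_integralZl//.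
    by apply: emeasurable_funM => //; exact: measurable_density.
  by move=> z _; rewrite mule_ge0.
rewrite fubini_tonelli.
- apply: eq_integral => z _; rewrite (density_CK P_dens s0 t0) -ge0_integralZr//.
  + by apply: eq_integral => y _; rewrite /F/= muleA.
  + apply: emeasurable_funM; first exact: measurable_density.
    exact: measurableT_comp (density_measurable P_dens t0) (pair2_measurable z).
  + by move=> y _; rewrite mule_ge0.
- apply: emeasurable_funM.
    by apply: (measurableT_comp (measurable_density x s0)) => //.
  apply: emeasurable_funM; last exact: measurableT_comp.
  exact: density_measurable P_dens _ t0.
- by move=> z; rewrite !mule_ge0.
Qed.

Lemma integral_kint_le t f : (0 <= t)%R ->
  measurable_fun setT f -> (forall y, 0 <= f y) ->
  \int[mu]_x kint t f x <= \int[mu]_x f x.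
Proof.
move=> t0 mf f0.
have -> : \int[mu]_x kint t f x = \int[mu]_x (kint t f x * cst 1 x).
  by apply: eq_integral => x _; rewrite mule1.
rewrite kint_sym//; apply: ge0_le_integral => //.
- by move=> x _; rewrite mule_ge0// kint_ge0.
- by apply: emeasurable_funM => //; exact: measurable_kint.
- move=> x _; rewrite -[leRHS]mule1 lee_wpmul2l//.
  by rewrite /kint integral_cst// mul1e sprob_kernel_le1.
Qed.

End NonnegSemigroup.
(** * The semigroup on L^2 *)

Section L2Semigroup.
Variables (R : realType) (E : ptopologicalType).
Variable mu : {sigma_finite_measure set (borel E) -> \bar R}.
Variable P : R -> R.-spker (borel E) ~> (borel E).
Variable p : R -> borel E -> borel E -> \bar R.
Hypothesis P_trans : transition_function P.
Hypothesis P_dens : transition_density mu P p.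
Implicit Types (t s : R) (x : borel E).

Lemma measurable_semigroup t (f : borel E -> R) : measurable_fun setT f ->
  measurable_fun setT (semigroup P t f).
Proof.
move=> mf; have {}mf : measurable_fun setT (EFin \o f) by exact/measurable_EFinP.
apply: (measurableT_comp (fine_measurable measurableT)).
under eq_fun do rewrite integralE.
apply: emeasurable_funB; apply: measurable_kint => //.
- exact: measurable_funepos.
- exact: measurable_funeneg.
Qed.

Lemma integrable_kernel_cst t x (c : R) : (P t x).-integrable setT (EFin \o cst c).
Proof.
apply: finite_measure_integrable_cst => //; exact: finite_kernel_measure.
Qed.

Lemma kint_sqr_integrable t (f : borel E -> R) x : measurable_fun setT f ->
  (kint P t (fun y => (f y ^+ 2)%:E) x < +oo)%E ->
  (P t x).-integrable setT (fun y => (f y ^+ 2)%:E) /\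
  (P t x).-integrable setT (EFin \o f).
Proof.
move=> mf fx.
have mf2 : measurable_fun setT (fun y => (f y ^+ 2)%:E).
  by apply/measurable_EFinP; exact: measurable_funX.
have f2i : (P t x).-integrable setT (fun y => (f y ^+ 2)%:E).
  apply/integrableP; split => //; apply: le_lt_trans fx.
  rewrite le_eqVlt; apply/orP; left; apply/eqP; apply: eq_integral => y _ /=.
  by rewrite ger0_norm ?sqr_ge0.
split=> //.
have : (P t x).-integrable setT (fun y => 1 + (f y ^+ 2)%:E)%E.
  by apply: integrableD => //; exact: (integrable_kernel_cst t x 1).
apply: le_integrable => //; first exact/measurable_EFinP.
move=> y _ /=; rewrite lee_fin [leRHS]ger0_norm ?addr_ge0 ?sqr_ge0//.
rewrite -[in leRHS](real_normK (num_real (f y))).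
have := sqr_ge0 (`|f y| - 1); have := normr_ge0 (f y); nra.
Qed.

(** Jensen's inequality for a measure m of mass at most 1: with A = m(f),
    integrating 2 A f - A^2 <= f^2 gives A^2 <= 2 A^2 - A^2 m(1) <= m(f^2). *)
Lemma semigroup_sqr_le t (f : borel E -> R) x : measurable_fun setT f ->
  ((semigroup P t f x ^+ 2)%:E <= kint P t (fun y => (f y ^+ 2)%:E) x)%E.
Proof.
move=> mf.
have [->|] := eqVneq (kint P t (fun y => (f y ^+ 2)%:E) x) +oo%E.
  by rewrite leey.
rewrite -ltey => /(kint_sqr_integrable mf)[f2i fi].
rewrite -[kint _ _ _ _]fineK; last exact: integrable_fin_num.
rewrite lee_fin.
set A := semigroup P t f x; set m := P t x.
have ci : m.-integrable setT (EFin \o cst (A ^+ 2)).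
  exact: integrable_kernel_cst.
have Afi : m.-integrable setT (EFin \o (fun y => 2 * A * f y)).
  by apply: eq_integrable (integrableZl measurableT (2 * A) fi).
have : \int[m]_y (2 * A * f y - A ^+ 2) <= \int[m]_y (f y ^+ 2).
  apply: le_Rintegral => //.
    have := integrableB measurableT Afi ci.
    by apply: eq_integrable.
  by move=> y _; have := sqr_ge0 (f y - A); lra.
rewrite RintegralB// RintegralZl// Rintegral_cst//.
have m1 : fine (m setT) <= 1.
  rewrite -lee_fin fineK ?sprob_kernel_le1//.
  exact: finite_kernel_measure.
have -> : \int[m]_y f y = A by [].
have := ler_wpM2l (sqr_ge0 A) m1; rewrite /Rintegral -/(kint _ _ _ _); lra.
Qed.

Lemma L2_sqr_measurable (f : L2 mu) : measurable_fun setT (fun y => (f y ^+ 2)%:E).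
Proof. by apply/measurable_EFinP/measurable_funX; exact: L2_mfun. Qed.

Lemma integral_semigroup_sqr_le t (f : L2 mu) : 0 <= t ->
  (\int[mu]_x (semigroup P t f x ^+ 2)%:E <= \int[mu]_x (f x ^+ 2)%:E)%E.
Proof.
move=> t0; have mf2 := L2_sqr_measurable f.
have f20 y : (0 <= (f y ^+ 2)%:E)%E by rewrite lee_fin sqr_ge0.
apply: le_trans (integral_kint_le P_trans P_dens t0 mf2 f20).
apply: ge0_le_integral => //.
- by move=> x _; rewrite lee_fin sqr_ge0.
- apply/measurable_EFinP; apply: measurable_funX.
  exact: (measurable_semigroup t (L2_mfun f)).
- exact: measurable_kint.
- by move=> x _; apply: semigroup_sqr_le; exact: L2_mfun.
Qed.

Lemma semigroup_Lfun t (f : L2 mu) : 0 <= t -> semigroup P t f \in Lfun mu 2%:E.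
Proof.
move=> t0; apply/Lfun2P; split; first exact: (measurable_semigroup t (L2_mfun f)).
apply: le_lt_trans (integral_semigroup_sqr_le f t0) _.
by have /Lfun2P[] := L2_Lfun f.
Qed.

Definition L2sg t (f : L2 mu) : L2 mu := to_L2 mu (semigroup P t f).

Lemma L2sgE t (f : L2 mu) : 0 <= t -> L2sg t f = semigroup P t f :> (_ -> _).
Proof. by move=> t0; rewrite /L2sg to_L2E// semigroup_Lfun. Qed.

(** Integrating P_t(f^2) over mu gives at most the integral of f^2, so P_t(f^2)
    is finite almost everywhere. *)
Lemma ae_integrable_kernel t (f : L2 mu) : 0 <= t ->
  {ae mu, forall x, (P t x).-integrable setT (EFin \o f)}.
Proof.
move=> t0; have mf2 := L2_sqr_measurable f.
have f20 y : (0 <= (f y ^+ 2)%:E)%E by rewrite lee_fin sqr_ge0.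
have /integrable_ae : mu.-integrable setT (kint P t (fun y => (f y ^+ 2)%:E)).
  apply/integrableP; split; first exact: measurable_kint.
  under eq_integral do rewrite gee0_abs ?kint_ge0//.
  apply: le_lt_trans (integral_kint_le P_trans P_dens t0 mf2 f20) _.
  by have /Lfun2P[] := L2_Lfun f.
move=> /(_ measurableT); apply: filterS => x /= /(_ I) fx.
have [|//] := @kint_sqr_integrable t f x (L2_mfun f).
by rewrite ltey_eq fx.
Qed.

Lemma L2sg_contr t (f : L2 mu) : 0 <= t -> ip2 (L2sg t f) (L2sg t f) <= ip2 f f.
Proof.
move=> t0; rewrite -!(ipnorm_sqr (ip2_semi mu)) -lee_fin !ipnorm2_sqr L2sgE//.
exact: integral_semigroup_sqr_le.
Qed.

Lemma ip2_L2sgB t (f g h : L2 mu) : 0 <= t ->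
  ip2 (L2sg t (f - g)) h = ip2 (L2sg t f) h - ip2 (L2sg t g) h.
Proof.
move=> t0; rewrite -(ipBl (ip2_semi mu)); apply: ip2_ae_eq; last exact: ae_eq_refl.
have := ae_integrable_kernel f t0; have := ae_integrable_kernel g t0.
apply: filterS2 => x gi fi _.
rewrite L2_subE !L2sgE// /semigroup -RintegralB//.
Qed.

(** For nonnegative functions, both inner products are integrals of
    nonnegative functions, and kernels can be moved by [kint_sym]. *)
Lemma ip2_L2sgM_ge0 s t (f g : L2 mu) : 0 <= s -> 0 <= t ->
  (forall x, 0 <= f x) -> (forall x, 0 <= g x) ->
  ip2 (L2sg s f) (L2sg t g) = ip2 (L2sg (s + t) f) g.
Proof.
move=> s0 t0 f0 g0; apply: EFin_inj; rewrite !ip2_EFin.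
have mE (h : L2 mu) : measurable_fun setT (EFin \o h).
  exact/measurable_EFinP/L2_mfun.
have TE r (h : L2 mu) : 0 <= r -> 
    {ae mu, forall x, (L2sg r h x)%:E = kint P r (EFin \o h) x}.
  move=> r0; have := ae_integrable_kernel h r0; apply: filterS => x hi.
  by rewrite L2sgE// fineK//; exact: integrable_fin_num.
transitivity (\int[mu]_x (kint P s (EFin \o f) x * kint P t (EFin \o g) x))%E.
  apply: ae_eq_integral => //.
  - by apply/measurable_EFinP/measurable_funM; exact: L2_mfun.
  - by apply: emeasurable_funM; apply: measurable_kint.
  - have := TE _ f s0; have := TE _ g t0; apply: filterS2 => x gx fx _.
    by rewrite EFinM gx fx.
rewrite -(kint_sym P_trans P_dens t0)//.
- apply: ae_eq_integral => //.
  + apply: emeasurable_funM => //; apply: measurable_kint => //.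
      exact: measurable_kint.
    by move=> y; apply: kint_ge0.
  + by apply/measurable_EFinP/measurable_funM; exact: L2_mfun.
  + have := TE _ f (addr_ge0 s0 t0); apply: filterS => x fx _.
    by rewrite EFinM fx (kintM P_trans P_dens)// addrC.
- exact: measurable_kint.
- by move=> y; apply: kint_ge0.
Qed.

Definition pos_part (f : L2 mu) : L2 mu := to_L2 mu (fun x => Num.max (f x) 0).

Lemma pos_partE (f : L2 mu) x : pos_part f x = Num.max (f x) 0.
Proof.
rewrite to_L2E//; apply: (@Lfun2_le _ _ _ _ _ f).
  by apply: measurable_maxr => //; exact: L2_mfun.
by move=> y; case: (leP (f y) 0) => fy; rewrite ?normr0.
Qed.

Lemma pos_part_ge0 (f : L2 mu) x : 0 <= pos_part f x.
Proof. by rewrite pos_partE le_max lexx orbT. Qed.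

Lemma pos_partB (f : L2 mu) : f = pos_part f - pos_part (- f).
Proof.
apply/LfuneqP => x; rewrite L2_subE !pos_partE.
rewrite (_ : (- f) x = - f x)//.
by case: (leP (f x) 0); case: (leP (- f x) 0); lra.
Qed.

Lemma ip2_L2sgM s t (f g : L2 mu) : 0 <= s -> 0 <= t ->
  ip2 (L2sg s f) (L2sg t g) = ip2 (L2sg (s + t) f) g.
Proof.
move=> s0 t0; have st0 := addr_ge0 s0 t0.
have semi := ip2_semi mu.
have ip2_L2sgBr r (f1 f2 h : L2 mu) : 0 <= r ->
    ip2 h (L2sg r (f1 - f2)) = ip2 h (L2sg r f1) - ip2 h (L2sg r f2).
  by move=> r0; rewrite (ipC semi) ip2_L2sgB// !(ipC semi _ h).
have key (f1 f2 g1 g2 : L2 mu) :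
    ip2 (L2sg s f1) (L2sg t g1) = ip2 (L2sg (s + t) f1) g1 ->
    ip2 (L2sg s f1) (L2sg t g2) = ip2 (L2sg (s + t) f1) g2 ->
    ip2 (L2sg s f2) (L2sg t g1) = ip2 (L2sg (s + t) f2) g1 ->
    ip2 (L2sg s f2) (L2sg t g2) = ip2 (L2sg (s + t) f2) g2 ->
    ip2 (L2sg s (f1 - f2)) (L2sg t (g1 - g2)) = ip2 (L2sg (s + t) (f1 - f2)) (g1 - g2).
  move=> E11 E12 E21 E22.
  rewrite (ip2_L2sgB f1 f2 _ s0) (ip2_L2sgB f1 f2 _ st0) !(ip2_L2sgBr t g1 g2)//.
  by rewrite !(ipBr semi g1 g2) E11 E12 E21 E22.
have pos := pos_part_ge0.
have := key (pos_part f) (pos_part (- f)) (pos_part g) (pos_part (- g)).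
by rewrite -!pos_partB; apply; exact: ip2_L2sgM_ge0.
Qed.

End L2Semigroup.
Section StrongContinuity.
Variables (R : realType) (E : ptopologicalType).
Variable mu : {sigma_finite_measure set (borel E) -> \bar R}.
Variable P : R -> R.-spker (borel E) ~> (borel E).
Variable p : R -> borel E -> borel E -> \bar R.
Hypothesis P_trans : transition_function P.
Hypothesis P_dens : transition_density mu P p.
Hypothesis P_cont : strongly_continuous mu P.
Local Notation ip2 := (@ip2 _ _ _ mu).
Local Notation norm2 := (ipnorm ip2).

Lemma near_right0P (Q : R -> Prop) :
  (\forall t \near 0^'+, Q t) <->
  exists2 d : R, 0 < d & forall t, 0 < t <= d -> Q t.
Proof.
split.
  move=> /nbhs_ballP[d /= d0 H]; exists (d / 2); first by rewrite divr_gt0.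
  move=> t /andP[t0 td]; apply: H => //.
  rewrite /ball/= sub0r normrN gtr0_norm// (le_lt_trans td)//.
  by rewrite ltr_pdivrMr// mulr_natr mulr2n ltrDl.
move=> [d d0 H]; near=> t; apply: H; apply/andP; split.
  by near: t; exact: nbhs_right_gt.
by near: t; exact: nbhs_right_le.
Unshelve. all: by end_near. Qed.

Lemma cvg_norm2P (n : R -> \bar R) (v : R -> L2 mu) :
  (forall t, 0 < t -> n t = (norm2 (v t))%:E) ->
  n t @[t --> 0^'+] --> 0%E <->
  forall e, 0 < e -> exists2 d, 0 < d &
    forall t, 0 < t <= d -> norm2 (v t) < e.
Proof.
move=> nv; split.
  move=> /fine_cvgP[_ /cvgrPdist_lt H] e e0.
  have /near_right0P[d d0 Hd] := H e e0; exists d => // t /[dup] td /andP[t0 _].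
  by have := Hd t td; rewrite /= sub0r normrN nv//= ger0_norm ?ipnorm_ge0.
move=> H; apply/fine_cvgP; split.
  by apply/near_right0P; exists 1 => // t /andP[t0 _]; rewrite nv.
apply/cvgrPdist_lt => e e0; apply/near_right0P.
have [d d0 Hd] := H e e0; exists d => // t /[dup] td /andP[t0 _].
by rewrite /= sub0r normrN nv//= ger0_norm ?ipnorm_ge0 ?Hd.
Qed.

Lemma L2sg_symm_semigroup : symm_semigroup ip2 (L2sg P).
Proof.
split.
- move=> f g; apply: eq_Rintegral => x _; rewrite (L2sgE P_trans P_dens)//.
  rewrite /semigroup /Rintegral -/(kint P 0 (EFin \o f) x) (kint0 P_trans)//.
  exact/measurable_EFinP/L2_mfun.
- by move=> s t f g s0 t0; apply: (ip2_L2sgM P_trans P_dens).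
- by move=> t f t0; exact: (L2sg_contr P_trans P_dens).
- move=> f e e0.
  have := P_cont (L2_Lfun f).
  move=> /(@cvg_norm2P _ (fun t => L2sg P t f - f)) H.
  have [|d d0 Hd] := H _ e e0.
    move=> t t0; rewrite ipnorm2E; congr (Lnorm _ _ _); apply/funext => x /=.
    by rewrite (L2sgE P_trans P_dens)// ltW.
  exists d => // t /andP[]; rewrite le_eqVlt => /predU1P[<- _|t0 td]; last first.
    by rewrite Hd// t0.
  rewrite (_ : L2sg P 0 f - f = 0) ?(ipnorm0 (ip2_semi mu))//.
  apply/LfuneqP => x; rewrite L2_subE (L2sgE P_trans P_dens)//.
  rewrite /semigroup /Rintegral -/(kint P 0 (EFin \o f) x) (kint0 P_trans)//.
    by rewrite /= subrr.
  exact/measurable_EFinP/L2_mfun.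
Qed.

Lemma generatorP (f g : L2 mu) :
  generator mu P f g <-> is_gen ip2 (L2sg P) f g.
Proof.
have H (t : R) : 0 < t -> 'N[mu]_2%:E[EFin \o
    (fun x => t^-1 * (semigroup P t f x - f x) - g x)%R]%E =
    (norm2 (t^-1 *: (L2sg P t f - f) - g))%:E.
  move=> t0; rewrite ipnorm2E; congr (Lnorm _ _ _); apply/funext => x /=.
  by rewrite (L2sgE P_trans P_dens)// ltW.
split; first by move=> [_ _ /(cvg_norm2P H)].
by move=> fg; split; [exact: L2_Lfun|exact: L2_Lfun|exact/(cvg_norm2P H)].
Qed.

End StrongContinuity.

(** * Pointwise bounds from the diagonal of the density *)

Section Pointwise.
Variables (R : realType) (E : ptopologicalType).
Variable mu : {sigma_finite_measure set (borel E) -> \bar R}.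
Variable P : R -> R.-spker (borel E) ~> (borel E).
Variable p : R -> borel E -> borel E -> \bar R.
Hypothesis P_trans : transition_function P.
Hypothesis P_dens : transition_density mu P p.
Variable a : R.
Hypothesis a_gt0 : 0 < a.
Hypothesis diag_fin : forall x, p (a + a) x x \is a fin_num.
Let semi := ip2_semi mu.
Hypothesis P_cont : strongly_continuous mu P.
Local Notation norm2 := (ipnorm (@ip2 _ _ _ mu)).

(** Cauchy-Schwarz in L^2(mu), since the integral of p_a(x, y)^2 in y is
    p_2a(x, x) by symmetry and the Chapman-Kolmogorov identity. *)
Lemma kint_abs_le x (f : L2 mu) :
  (kint P a (fun y => `|f y|%:E) x <=
    (Num.sqrt (fine (p (a + a)%R x x)) * norm2 f)%:E)%E.
Proof.
have p0 y := density_ge0 P_dens a_gt0 x y.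
have mp := measurable_density P_dens x a_gt0.
have pp : (\int[mu]_y (p a x y * p a x y) = p (a + a)%R x x)%E.
  rewrite (density_CK P_dens a_gt0 a_gt0); apply: eq_integral => y _.
  by rewrite (density_sym P_dens a_gt0 y x).
have p_ae : {ae mu, forall y, p a x y \is a fin_num}.
  have : mu.-integrable setT (fun y => p a x y * p a x y)%E.
    apply/integrableP; split; first exact: emeasurable_funM.
    under eq_integral do rewrite gee0_abs ?mule_ge0//.
    by rewrite pp ltey_eq diag_fin.
  move=> /integrable_ae -/(_ measurableT); apply: filterS => y /(_ I).
  by have := p0 y; case: (p a x y) => //.
pose q y := fine (p a x y).
have mq : measurable_fun setT q by exact: (measurableT_comp (fine_measurable measurableT)).
have qE : (\int[mu]_y (q y ^+ 2)%:E = p (a + a)%R x x)%E.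
  rewrite -pp; apply: ae_eq_integral => //.
  - by apply/measurable_EFinP; exact: measurable_funX.
  - exact: emeasurable_funM.
  - by apply: filterS p_ae => y /fineK yE _; rewrite EFinM yE.
have qL : q \in Lfun mu 2%:E by apply/Lfun2P; rewrite qE ltey_eq diag_fin.
have mf : measurable_fun setT (fun y => `|f y|).
  by apply: measurableT_comp => //; exact: L2_mfun.
have fL : (fun y => `|f y|) \in Lfun mu 2%:E.
  by apply: (@Lfun2_le _ _ _ _ _ f) => // y; rewrite normr_id.
have -> : kint P a (fun y => `|f y|%:E) x =
    (ip2 (to_L2 mu q) (to_L2 mu (fun y => `|f y|)))%:E.
  rewrite ip2_EFin !to_L2E// (kintE P_dens)//; last exact/measurable_EFinP.
  apply: ae_eq_integral => //.
  - by apply: emeasurable_funM => //; exact/measurable_EFinP.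
  - by apply/measurable_EFinP; exact: measurable_funM.
  - by apply: filterS p_ae => y /fineK yE _; rewrite EFinM yE.
rewrite lee_fin (le_trans (ip_le_norm semi _ _))//.
have -> : norm2 (to_L2 mu q) = Num.sqrt (fine (p (a + a) x x)).
  rewrite -qE -[in RHS](to_L2E qL) -ipnorm2_sqr/= sqrtr_sqr ger0_norm//.
rewrite le_eqVlt; apply/orP; left; apply/eqP; congr (_ * _).
apply: EFin_inj; rewrite !ipnorm2E !Lnorm2E; congr (_ `^ _)%E.
by apply: eq_integral => y _; rewrite to_L2E// real_normK ?num_real.
Qed.

Lemma integrable_kernel x (f : L2 mu) : (P a x).-integrable setT (EFin \o f).
Proof.
apply/integrableP; split; first exact/measurable_EFinP/L2_mfun.
by apply: le_lt_trans (kint_abs_le x f) _; rewrite ltry.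
Qed.

Lemma semigroup_le x (f : L2 mu) :
  `|semigroup P a f x| <= Num.sqrt (fine (p (a + a) x x)) * norm2 f.
Proof.
rewrite -lee_fin EFin_normr_Rintegral//; last exact: integrable_kernel.
apply: le_trans (kint_abs_le x f); apply: le_abse_integral => //.
exact/measurable_EFinP/L2_mfun.
Qed.

Lemma semigroup_sub_le x (f g : L2 mu) :
  `|semigroup P a f x - semigroup P a g x| <=
    Num.sqrt (fine (p (a + a) x x)) * norm2 (f - g).
Proof.
apply: le_trans (semigroup_le x (f - g)).
by rewrite /semigroup -RintegralB//; exact: integrable_kernel.
Qed.

(** By [semigroup_sub_le], the functions P_a (u n) converge at every point; Fatou's
    lemma identifies the pointwise limit as the limit in L^2(mu). *)
Lemma semigroup_complete (u : nat -> L2 mu) : is_cauchy (@ip2 _ _ _ mu) u ->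
  exists G, converges (@ip2 _ _ _ mu) (L2sg P a \o u) G.
Proof.
move=> u_cauchy.
have a0 := ltW a_gt0.
have sg := L2sg_symm_semigroup P_trans P_dens P_cont.
pose v n x := semigroup P a (u n) x.
have mv n : measurable_fun setT (v n).
  exact: (measurable_semigroup P a (L2_mfun (u n))).
have v_cvg x : cvgn (v ^~ x).
  apply/cauchy_cvgP/cauchy_exP => e e0 /=.
  set c := Num.sqrt (fine (p (a + a) x x)).
  have c1 : 0 < c + 1 by rewrite ltr_wpDl// sqrtr_ge0.
  have [N HN] := u_cauchy _ (divr_gt0 e0 c1).
  exists (v N x); exists N => // n /= Nn.
  rewrite /ball/= (le_lt_trans (semigroup_sub_le x _ _))//.
  rewrite (@le_lt_trans _ _ ((c + 1) * norm2 (u N - u n)))//.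
    by rewrite ler_wpM2r// lerDl.
  by rewrite mulrC -ltr_pdivlMr// HN.
pose g x := limn (v ^~ x).
have mg : measurable_fun setT g.
  apply: (measurable_fun_cvg mv) => x _; exact: v_cvg.
have limit_le e N : 0 < e ->
    (forall n, (N <= n)%N -> norm2 (u N - u n) <= e) ->
    (\int[mu]_x ((v N x - g x) ^+ 2)%:E <= (e ^+ 2)%:E)%E.
  move=> e0 HN.
  pose F n x := ((v N x - v n x) ^+ 2)%:E.
  have -> : (\int[mu]_x ((v N x - g x) ^+ 2)%:E =
             \int[mu]_x limn_einf (F ^~ x))%E.
    apply: eq_integral => x _; apply/esym.
    have Fc : F ^~ x @ \oo --> ((v N x - g x) ^+ 2)%:E.
      apply/fine_cvgP; split; first exact: nearW.
      rewrite [X in X @ _ --> _](_ : _ =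
        (fun n => (v N x - v n x) * (v N x - v n x))); last exact/funext.
      by apply: cvgM; apply: cvgB; (exact: cvg_cst || exact: v_cvg).
    rewrite is_cvg_limn_einfE; last by apply/cvg_ex; eexists; exact: Fc.
    exact: cvg_lim Fc.
  apply: le_trans (fatou _ _ _ _) _ => //.
  - by move=> n; apply/measurable_EFinP; apply: measurable_funX;
      exact: measurable_funB.
  - by move=> n x _; rewrite lee_fin sqr_ge0.
  rewrite limn_einf_lim; apply: lime_le; first exact: is_cvg_einfs.
  apply: nearW => n; pose m := maxn n N.
  apply: (@le_trans _ _ (\int[mu]_x F m x)%E).
    by apply: ereal_inf_lbound; exists m => //=; rewrite leq_maxl.
  have -> : (\int[mu]_x F m x = (norm2 (L2sg P a (u N) - L2sg P a (u m)) ^+ 2)%:E)%E.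
    rewrite ipnorm2_sqr; apply: eq_integral => x _.
    by rewrite L2_subE !(L2sgE P_trans P_dens).
  rewrite lee_fin ler_pXn2r ?nnegrE ?ipnorm_ge0 ?(ltW e0)//.
  rewrite (ipnorm_semigroupB semi sg)//.
  by apply: (le_trans (ipnorm_contr sg _ a0)); apply: HN; rewrite leq_maxr.
have [N0 HN0] := u_cauchy 1 ltr01.
have gL : g \in Lfun mu 2%:E.
  have dL : (fun x => v N0 x - g x) \in Lfun mu 2%:E.
    apply/Lfun2P; split; first exact: measurable_funB.
    apply: (@le_lt_trans _ _ (1 ^+ 2)%:E); last exact: ltry.
    by apply: (limit_le 1 N0 ltr01) => n n0; apply/ltW/HN0.
  rewrite (_ : g = L2sg P a (u N0) - to_L2 mu (fun x => v N0 x - g x)).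
    exact: L2_Lfun.
  by apply/funext => x; rewrite L2_subE (L2sgE P_trans P_dens)// to_L2E// subKr.
exists (to_L2 mu g) => e e0.
have e20 : 0 < e / 2 by rewrite divr_gt0.
have [N HN] := u_cauchy _ e20; exists N => n Nn.
apply: (@le_lt_trans _ _ (e / 2)); last by rewrite ltr_pdivrMr// mulr_natr mulr2n ltrDl.
rewrite -(@ler_pXn2r _ 2) ?nnegrE ?ipnorm_ge0 ?(ltW e20)// -lee_fin ipnorm2_sqr.
have -> : (\int[mu]_x ((L2sg P a (u n) - to_L2 mu g) x ^+ 2)%:E =
           \int[mu]_x ((v n x - g x) ^+ 2)%:E)%E.
  by apply: eq_integral => x _; rewrite L2_subE (L2sgE P_trans P_dens)// to_L2E//.
apply: (limit_le _ n e20) => m nm; apply/ltW/HN => //; exact: leq_trans nm.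
Qed.

End Pointwise.
(** * Comparison of the two rates *)

Section Rates.
Variables (R : realType) (E : ptopologicalType).
Variable mu : {sigma_finite_measure set (borel E) -> \bar R}.
Variable P : R -> R.-spker (borel E) ~> (borel E).
Variable p : R -> borel E -> borel E -> \bar R.
Variable C : set (borel E -> R).
Hypothesis E_hausdorff : hausdorff_space E.
Hypothesis mu_compact : finite_on_compacts mu.
Hypothesis P_trans : transition_function P.
Hypothesis P_dens : transition_density mu P p.
Hypothesis P_cont : strongly_continuous mu P.
Hypothesis C_core : is_core mu P C.

Let semi := ip2_semi mu.
Let sg := L2sg_symm_semigroup P_trans P_dens P_cont.
Local Notation ip2 := (@ip2 _ _ _ mu).
Local Notation norm2 := (ipnorm ip2).

Lemma compact_measurable (K : set E) : compact K -> measurable (K : set (borel E)).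
Proof.
move=> /(compact_closed E_hausdorff); rewrite -openC => oK.
rewrite -[K]setCK; apply: measurableC; exact: sub_sigma_algebra.
Qed.

Lemma exp_rate0 : exp_rate mu P 0.
Proof.
split=> // K cK; exists (cst 1).
  split; first exact: measurable_cst.
  move=> K' cK'; have mK' := compact_measurable cK'.
  apply/integrableP; split; first exact/measurable_EFinP/measurable_cst.
  under eq_integral do rewrite /= normr1.
  by rewrite integral_cst// mul1e mu_compact.
move=> t x t0; rewrite oppr0 mul0r expR0 mulr1.
apply: le_trans (sprob_kernel_le1 (P t) x); apply: le_measure; rewrite ?inE//.
exact: compact_measurable.
Qed.

Lemma semigroup_bounded_le t x (g : borel E -> R) (M : R) (K : set E) :
  compact K -> measurable_fun setT g -> (forall y, `|g y| <= M) ->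
  (forall y, g y != 0 -> K y) ->
  (`|semigroup P t g x|%:E <= M%:E * P t x K)%E.
Proof.
move=> cK mg gM gK; have mK := compact_measurable cK.
have gi : (P t x).-integrable setT (EFin \o g).
  apply: (le_integrable measurableT _ _ (integrable_kernel_cst P t x M)).
    exact/measurable_EFinP.
  by move=> y _ /=; rewrite lee_fin (le_trans (gM y))// ler_norm.
rewrite EFin_normr_Rintegral//.
apply: le_trans (le_abse_integral _ measurableT _) _; first exact/measurable_EFinP.
rewrite -integral_cst// [leRHS]integral_mkcond.
have M0 : 0 <= M by exact: le_trans (gM point).
apply: ge0_le_integral => //.
- by apply: measurableT_comp => //; exact/measurable_EFinP.
- apply/(measurable_restrictT _ mK); exact: measurable_cst.
move=> y _; rewrite patchE; case: ifPn => yK /=; first by rewrite lee_fin.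
suff -> : g y = 0 by rewrite normr0.
by apply: contraNeq yK => /gK; rewrite inE.
Qed.

(** With |g| <= M 1_K one has |P_t g|^2 = <P_2t g, g>, which is at most
    M^2 int_K P_2t(x, K) mu(dx) <= M^2 e^(- 2 eps t) int_K c dmu; the constant is
    removed by [decays_boost]. *)
Lemma exp_rate_decays eps (g : L2 mu) : exp_rate mu P eps ->
  bounded_compact_support g -> decays ip2 (L2sg P) eps g.
Proof.
move=> [eps0 Heps] [mg [M gM] cK].
set K := closure _ in cK.
have gK y : g y != 0 -> K y by move=> gy; apply: subset_closure.
have mK := compact_measurable cK.
have M0 : 0 <= M by exact: le_trans (gM point).
have [c [mc ci] Hc] := Heps K cK.
have c0 x : 0 <= c x.
  have := Hc 0 x (lexx 0); rewrite mulr0 expR0 mulr1 -lee_fin; exact: le_trans.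
pose A := \int[mu]_(x in K) c x.
have A0 : 0 <= A by apply: Rintegral_ge0.
have AE : (A%:E = \int[mu]_(x in K) (c x)%:E)%E.
  by rewrite fineK//; apply: integrable_fin_num => //; exact: ci.
apply: (@decays_boost _ _ _ semi _ sg _ (M * Num.sqrt A)) => t t0.
have tt0 : 0 <= t + t by exact: addr_ge0.
rewrite -(@ler_pXn2r _ 2) ?nnegrE ?ipnorm_ge0 ?mulr_ge0 ?sqrtr_ge0 ?expR_ge0//.
rewrite (ipnorm_semigroup_sqr semi sg)// !exprMn sqr_sqrtr// [expR _ ^+ 2]expr2 -expRD.
rewrite -mulrDr -lee_fin ip2_EFin.
set k := M ^+ 2 * expR (- eps * (t + t)).
have k0 : 0 <= k by rewrite mulr_ge0 ?sqr_ge0 ?expR_ge0.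
have -> : (M ^+ 2 * A * expR (- eps * (t + t)))%:E = (k%:E * A%:E)%E.
  by rewrite -EFinM; congr EFin; rewrite /k; ring.
have mcK : measurable_fun (K : set (borel E)) (EFin \o c).
  exact: measurable_int (ci _ cK).
rewrite AE -ge0_integralZl_EFin//; last by move=> x _; rewrite lee_fin.
apply: le_trans (lee_abs _) _.
apply: le_trans (le_abse_integral _ measurableT _) _.
  by apply/measurable_EFinP/measurable_funM; exact: L2_mfun.
rewrite [leRHS]integral_mkcond; apply: ge0_le_integral => //.
- apply: measurableT_comp => //.
  by apply/measurable_EFinP/measurable_funM; exact: L2_mfun.
- apply/(measurable_restrictT _ mK).
  exact: measurable_funeM.
move=> x _; rewrite patchE; case: ifPn => xK.
  rewrite (L2sgE P_trans P_dens)//= normrM -EFinM.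
  have H1 := semigroup_bounded_le (t + t) x cK mg gM gK.
  have H2 := Hc _ x tt0.
  have H3 : `|semigroup P (t + t) g x| <= M * (c x * expR (- eps * (t + t))).
    rewrite -lee_fin (le_trans H1)// EFinM lee_wpmul2l ?lee_fin//.
  rewrite lee_fin (le_trans (ler_pM _ _ H3 (gM x)))// le_eqVlt; apply/orP; left.
  by apply/eqP; rewrite /k; ring.
suff -> : g x = 0 by rewrite mulr0 /= normr0.
by apply: contraNeq xK => /gK; rewrite inE.
Qed.

Lemma exp_rate_le_lambda0 (Kset : set (borel E -> R)) eps :
  (forall f, Kset f -> bounded_compact_support f) -> dense_in_L2 mu Kset ->
  exp_rate mu P eps -> (eps%:E <= lambda0 mu P C)%E.
Proof.
move=> Kb [KL Kd] He; have [eps0 _] := He.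
apply: le_ereal_inf_tmp => _ [f [g [Cf fg f1 ->]]].
have [fL gL _] := fg.
have dec : decays ip2 (L2sg P) eps (to_L2 mu f).
  apply: (decays_closed semi sg) => // e e0.
  have [h Kh fh] := Kd f fL e e0.
  have hL : h \in Lfun mu 2%:E by exact: KL.
  exists (to_L2 mu h).
    by apply: exp_rate_decays => //; rewrite to_L2E//; exact: Kb.
  rewrite -lte_fin ipnorm2E; apply: le_lt_trans fh.
  rewrite le_eqVlt; apply/orP; left; apply/eqP; congr (Lnorm _ _ _).
  by apply/funext => x /=; rewrite !to_L2E.
have fg2 : is_gen ip2 (L2sg P) (to_L2 mu f) (to_L2 mu g).
  by apply/(generatorP P_trans P_dens); rewrite !to_L2E.
have := decays_gen semi sg eps0 dec fg2.
have -> : ip2 (to_L2 mu f) (to_L2 mu f) = 1.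
  apply: EFin_inj; rewrite ip2_EFin -f1; apply: eq_integral => x _.
  by rewrite to_L2E.
rewrite mulr1 -lee_fin; congr (_ <= (- _)%:E)%E.
by apply: eq_Rintegral => x _; rewrite !to_L2E.
Qed.

(** On the core, the inequality is the definition of lambda_0 applied to f / |f|;
    a null vector f, which cannot be normalized, satisfies <f, g> = 0. *)
Lemma lambda0_gen eta (f g : L2 mu) : 0 <= eta -> (eta%:E <= lambda0 mu P C)%E ->
  is_gen ip2 (L2sg P) f g -> eta * ip2 f f <= - ip2 f g.
Proof.
move=> eta0 Heta; have [C_lin C_dom C_dense] := C_core.
apply: (@gen_core _ _ _ semi _ eta (fun f : L2 mu => C f)) => //.
  move=> {}f {}g /(generatorP P_trans P_dens) fg e e0.
  have [f' [g' [Cf' fg' ff gg]]] := C_dense _ _ fg e e0.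
  have [fL gL _] := fg'.
  exists (to_L2 mu f'), (to_L2 mu g'); split.
  - by rewrite to_L2E.
  - by apply/(generatorP P_trans P_dens); rewrite !to_L2E.
  - rewrite -lte_fin ipnorm2E; apply: le_lt_trans ff.
    rewrite le_eqVlt; apply/orP; left; apply/eqP; congr (Lnorm _ _ _).
    by apply/funext => x /=; rewrite to_L2E.
  - rewrite -lte_fin ipnorm2E; apply: le_lt_trans gg.
    rewrite le_eqVlt; apply/orP; left; apply/eqP; congr (Lnorm _ _ _).
    by apply/funext => x /=; rewrite to_L2E.
move=> {}f {}g Cf fg.
have [f0|f0] := eqVneq (norm2 f) 0.
  have := ler_ip_normM semi f g; rewrite f0 mul0r normr_le0 => /eqP ->.
  by rewrite -(ipnorm_sqr semi) f0 expr0n mulr0 oppr0.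
pose b := (norm2 f)^-1.
have bf : C (b *: f).
  (* C is only assumed closed under a * f + g; taking g = 0 gives scaling. *)
  have C0 : C (fun x => -1 * f x + f x) by exact: C_lin.
  have := C_lin b _ _ Cf C0; congr C; apply/funext => x.
  by rewrite mulN1r addNr addr0.
have H : (lambda0 mu P C <= (- ip2 (b *: f) (b *: g))%:E)%E.
  apply: ereal_inf_lbound; exists (b *: f), (b *: g); split=> //.
    by apply/(generatorP P_trans P_dens)/(is_genZ semi sg).
  rewrite -ipnorm2_sqr (ipnormZ semi) exprMn real_normK ?num_real//.
  by rewrite -exprMn mulVf// expr1n.
have := le_trans Heta H.
rewrite lee_fin (ipZl semi) (ipZr semi) mulrA -expr2.
rewrite -(ipnorm_sqr semi) exprVn => Hb.
have n0 : 0 < norm2 f ^+ 2 by rewrite exprn_even_gt0.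
by rewrite -ler_pdivlMr// mulNr mulrC -mulNr mulNr.
Qed.

(** For t >= a, P_t(x, K) = P_a (P_(t - a) 1_K)(x) is bounded by [semigroup_le] and
    the decay of 1_K; for t < a, it is at most 1 <= e^(eta a) e^(- eta t). *)
Lemma exp_rate_of_le_lambda0 s eta : 0 < s ->
  in_Lhalf_loc mu (fun x => p s x x) -> 0 <= eta ->
  (eta%:E <= lambda0 mu P C)%E -> exp_rate mu P eta.
Proof.
move=> s0 [s_fin ms s_int] eta0 Heta; split=> // K cK.
have mK := compact_measurable cK.
pose a := s / 2.
have a0 : 0 < a by rewrite divr_gt0.
have aE : a + a = s by rewrite -splitr.
have diag_fin x : p (a + a) x x \is a fin_num by rewrite aE.
have dec := gen_decays_all semi sg (ltW a0) eta0
  (semigroup_complete P_trans P_dens a0 diag_fin P_cont)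
  (fun f g => lambda0_gen eta0 Heta).
have KL : (\1_K : borel E -> R) \in Lfun mu 2%:E.
  apply/Lfun2P; split; first exact: measurable_indic.
  have -> : (\int[mu]_x ((\1_K x : R) ^+ 2)%:E = mu K)%E.
    rewrite -(setIT K) -integral_indic// setIT; apply: eq_integral => x _.
    by rewrite indicE; case: (_ \in _); rewrite ?expr1n ?expr0n.
  exact: mu_compact.
pose k := to_L2 mu \1_K.
pose c x := expR (eta * a) * (1 + Num.sqrt (fine (p s x x)) * norm2 k).
have PK t x : fine (P t x K) = semigroup P t k x.
  by rewrite /semigroup /k to_L2E// /Rintegral integral_indic// setIT.
have Pfin t x : P t x K \is a fin_num.
  rewrite ge0_fin_numE//; apply: le_lt_trans (ltry 1).
  apply: le_trans (sprob_kernel_le1 (P t) x).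
  by apply: le_measure; rewrite ?inE.
exists c.
  have ms2 : measurable_fun [set: borel E] (fun x => Num.sqrt (fine (p s x x))).
    apply: (measurableT_comp (continuous_measurable_fun (@sqrt_continuous R))).
    exact: (measurableT_comp (fine_measurable measurableT) ms).
  split.
    apply: measurable_funM => //; apply: measurable_funD => //.
    exact: measurable_funM.
  move=> K' cK'; have mK' := compact_measurable cK'.
  have i1 : mu.-integrable (K' : set (borel E)) (cst 1%E).
    apply/integrableP; split; first exact: measurable_cst.
    under eq_integral do rewrite /= normr1.
    by rewrite integral_cst// mul1e mu_compact.
  have is2 : mu.-integrable (K' : set (borel E))
      (fun x => (Num.sqrt (fine (p s x x)))%:E).
    apply/integrableP; split.
      by apply/measurable_EFinP; exact: measurable_funTS.
    apply: le_lt_trans (s_int _ cK').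
    rewrite le_eqVlt; apply/orP; left; apply/eqP; apply: eq_integral => x _.
    rewrite /= ger0_norm ?sqrtr_ge0// -[in RHS](fineK (s_fin x)) poweR_EFin.
    by rewrite powR12_sqrt// fine_ge0// (density_ge0 P_dens).
  have := integrableZl mK' (expR (eta * a))
    (integrableD mK' i1 (integrableZl mK' (norm2 k) is2)).
  apply: eq_integrable => // x _ /=.
  by rewrite /c [_ * norm2 k]mulrC.
move=> t x t0.
have n0 := ipnorm_ge0 ip2 k.
have [ta|ta] := leP a t; last first.
  apply: (@le_trans _ _ 1%E).
    apply: le_trans (sprob_kernel_le1 (P t) x).
    by apply: le_measure; rewrite ?inE.
  rewrite lee_fin /c mulrAC -expRD.
  rewrite -[leLHS]mulr1 ler_pM ?lerDl ?mulr_ge0 ?sqrtr_ge0//.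
  rewrite -[leLHS]expR0 ler_expR.
  have : 0 <= eta * (a - t) by rewrite mulr_ge0// subr_ge0 ltW.
  by lra.
have ta0 : 0 <= t - a by rewrite subr_ge0.
have E1 : P t x K = kint P a (EFin \o L2sg P (t - a) k) x.
  rewrite -{1}(subrKC a t).
  have [_ ->//] := P_trans; last exact: ltW.
  apply: eq_integral => y _; rewrite /= (L2sgE P_trans P_dens)// -PK fineK//.
rewrite -[leLHS]fineK// lee_fin.
have -> : fine (P t x K) = semigroup P a (L2sg P (t - a) k) x by rewrite E1.
apply: le_trans (ler_norm _) _.
apply: le_trans (semigroup_le P_dens a0 diag_fin _ _) _.
rewrite aE /c mulrAC -expRD.
have -> : eta * a + - eta * t = - eta * (t - a) by ring.
rewrite mulrDr mulr1.
have := dec k _ ta0; have := expR_ge0 (- eta * (t - a)).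
have := sqrtr_ge0 (fine (p s x x)).
move: (Num.sqrt _) (norm2 _) (norm2 _) (expR _) => u v w e u0 e0 H.
have := ler_wpM2l u0 H; nra.
Qed.

End Rates.

(* The second conjunct says that the supremum eps_max is attained whenever it
   is finite, i.e. that it is a maximal rate. *)
Theorem proposition6p1 (R : realType) (E : ptopologicalType)
    (mu : {sigma_finite_measure set (borel E) -> \bar R})
    (P : R -> R.-spker (borel E) ~> (borel E))
    (p : R -> borel E -> borel E -> \bar R)
    (C Kset : set (borel E -> R)) :
  hausdorff_space E ->
  finite_on_compacts mu ->
  transition_function P ->
  mu_symmetric mu P ->
  strongly_continuous mu P ->
  is_core mu P C ->
  transition_density mu P p ->
  (exists2 s : R, 0 < s & in_Lhalf_loc mu (fun x => p s x x)) ->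
  (forall f, Kset f -> bounded_compact_support f) ->
  dense_in_L2 mu Kset ->
  lambda0 mu P C = eps_max mu P /\
  (forall eps : R, eps_max mu P = eps%:E -> exp_rate mu P eps).
Proof.
move=> hE mu_c P_tr _ P_co C_c P_de [s s0 s_half] Kb Kd.
have rate0 : exp_rate mu P 0 by exact: exp_rate0.
have upper := exp_rate_le_lambda0 C hE P_tr P_de P_co Kb Kd.
have lower := exp_rate_of_le_lambda0 hE mu_c P_tr P_de P_co C_c s0 s_half.
have eps0 : (0 <= eps_max mu P)%E by apply: ereal_sup_ubound; exists 0.
have E1 : lambda0 mu P C = eps_max mu P.
  apply/eqP; rewrite eq_le; apply/andP; split; last first.
    by apply: ge_ereal_sup => _ [eps He <-]; exact: upper.
  case El : (lambda0 mu P C) => [r| |]; last exact: leNye.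
    apply: ereal_sup_ubound; exists r => //; apply: lower; rewrite ?El//.
    by rewrite -lee_fin -El; exact: upper.
  rewrite leye_eq; apply/eqP/eqyP => r r0.
  by apply: ereal_sup_ubound; exists r => //; apply: lower; rewrite ?El ?leey// ltW.
split=> // eps epsE; apply: lower.
  by rewrite -lee_fin -epsE.
by rewrite E1 epsE.
Qed.
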